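(* Let $T>0$, let $\{W(t);\,t\ge 0\}$ be a standard Wiener process, let $\bar R(T)=\sup_{(0,T)}W(t)-\inf_{(0,T)}W(t)$ be its range over the time interval $(0,T)$, and let $R(T)=\lfloor \bar R(T)\rfloor$. For real $h>0$ put $$G_T(h)=\sum_{k=1}^{\infty}\left(\frac{8}{(2k-1)^2\pi^2}+\frac{8T}{h^2}\right)\exp\left[-\frac{(2k-1)^2\pi^2T}{2h^2}\right],$$ and put $G_T(0)=0$. Then for every integer $r\ge 0$ the probability mass function of $R(T)$ is $$P[R(T)=r]=G_T(r+1)-G_T(r),$$ and the cumulative distribution function of $R(T)$ is $$P[R(T)\le r]=G_T(r+1)=\sum_{k=1}^{\infty}\left(\frac{8}{(2k-1)^2\pi^2}+\frac{8T}{(r+1)^2}\right)\exp\left[-\frac{(2k-1)^2\pi^2T}{2(r+1)^2}\right].$$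
   Context: A standard Wiener process is a one-dimensional Brownian motion with continuous paths, $W(0)=0$, and $W(t)-W(s)\sim N(0,t-s)$ for $0\le s<t$. The symbol $\lfloor x\rfloor$ denotes the greatest integer not exceeding $x$. The law of $R(T)$ on $\{0,1,2,\dots\}$ is called the discrete distribution for a Wiener process range (DDWPR). *)

(* Defs.v *)
From HB Require Import structures.
From mathcomp Require Import all_boot all_order all_algebra.
From mathcomp Require Import all_classical all_reals all_analysis measurable_realfun.
Set Implicit Arguments.
Unset Strict Implicit.
Unset Printing Implicit Defensive.
Import Order.TTheory GRing.Theory Num.Theory.
Import numFieldNormedType.Exports.
Local Open Scope classical_set_scope.
Local Open Scope ring_scope.

(* Mutual independence of X_0, ..., X_(n-1).  The sets A i may be the whole
   line, so the product rule for subfamilies is included. *)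
Definition mutually_independent (d : measure_display) (Omega : measurableType d)
    (R : realType) (P : probability Omega R) (n : nat)
    (X : 'I_n -> {RV P >-> R}) : Prop :=
  forall A : 'I_n -> set R, (forall i, measurable (A i)) ->
    P (\bigcap_(i in [set: 'I_n]) (X i @^-1` A i)) =
    (\prod_(i < n) P (X i @^-1` A i))%E.

Definition increment (d : measure_display) (Omega : measurableType d)
    (R : realType) (P : probability Omega R) (W : R -> {RV P >-> R})
    (s t : R) : {RV P >-> R} := (W t \- W s)%R.

(* Time is t >= 0: the values W t for t < 0 are unconstrained and irrelevant.
   The second argument of [normal_prob] is the standard deviation. *)
Record standard_wiener_process (d : measure_display)
    (Omega : measurableType d) (R : realType) (P : probability Omega R)
    (W : R -> {RV P >-> R}) : Prop := {
  wiener_start : forall w, W 0 w = 0 ;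
  wiener_continuous : forall w,
    {within `[0, +oo[, continuous (fun t : R => W t w)} ;
  wiener_normal : forall s t : R, 0 <= s -> s < t ->
    forall A : set R, measurable A ->
    distribution P (increment W s t) A =
    normal_prob 0 (Num.sqrt (t - s)) A ;
  wiener_independent : forall (n : nat) (t : nat -> R),
    0 <= t 0%N -> {homo t : i j / (i <= j)%N >-> i <= j} ->
    mutually_independent (fun i : 'I_n => increment W (t i) (t i.+1))
}.

(* [sup] and [inf] are real-valued; they are the true bounds here because a
   continuous path is bounded on `]0, T[. *)
Definition wiener_range (d : measure_display) (Omega : measurableType d)
    (R : realType) (P : probability Omega R) (W : R -> {RV P >-> R})
    (T : R) (w : Omega) : R :=
  sup [set W t w | t in `]0, T[] - inf [set W t w | t in `]0, T[].

Definition discrete_range (d : measure_display) (Omega : measurableType d)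
    (R : realType) (P : probability Omega R) (W : R -> {RV P >-> R})
    (T : R) (w : Omega) : int :=
  Num.floor (wiener_range W T w).

Definition ddwpr_term (R : realType) (T h : R) (k : nat) : R :=
  (8 / ((2 * k%:R - 1) ^+ 2 * pi ^+ 2) + 8 * T / h ^+ 2) *
  expR (- ((2 * k%:R - 1) ^+ 2 * pi ^+ 2 * T / (2 * h ^+ 2))).

(* The terms are nonnegative for T > 0, so the series is summed in the extended
   reals, where its sum always exists.  Only h >= 0 is meaningful. *)
Definition ddwpr_G (R : realType) (T h : R) : \bar R :=
  if h == 0 then 0%E else (\sum_(1 <= k <oo) (ddwpr_term T h k)%:E)%E.

(* Main.v *)
Require Import Defs.
From HB Require Import structures.
From mathcomp Require Import all_boot all_order all_algebra.
From mathcomp Require Import all_classical all_reals all_analysis measurable_realfun.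
From mathcomp Require Import ring lra.
Import Order.TTheory GRing.Theory Num.Theory.
Import numFieldNormedType.Exports.
Local Open Scope classical_set_scope.
Local Open Scope ring_scope.

(** Let m, M be the infimum and the supremum of the path, so that M - m is the
    range, fix h > 0 and an odd integer o, and put k = o pi / h.  The whole
    argument rests on one function of the corner (m, M) and of the position x:

      C(m, M, x) = 2 cos (k (x - (m + M) / 2)) cos (k min(M - m, h) / 2).

    While M - m <= h it equals cos (k (x - m)) + cos (k (x - M)), and it is 0
    afterwards, continuously, because k h / 2 is an odd multiple of pi / 2.  In
    x it is an eigenfunction of the second derivative, for the eigenvalue
    - k^2, and its derivative in M (resp. m) vanishes at x = M (resp. x = m),
    the only position from which M (resp. m) moves.  Hence exp (k^2 t / 2) C(m_t, M_t, W_t) is a martingale, and at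
    time T

      E C(m, M, W_T) = C(0, 0, 0) exp (- k^2 T / 2) = 2 exp (- k^2 T / 2),

    which is corner_expectation.  The martingale property is used in discrete
    form.  On a grid the increments of the path are independent and symmetric, so their joint law does not change when the signs of all
    increments after a given index are flipped (flip_integral).  Averaging over
    this reflection replaces the end point of the path by an intermediate one
    (corner_reflection_principle), and then the expectation of C changes in one
    step by a quantity of second order in the steps of the path
    (corner_path_variation), which disappears when the grid is refined, by
    continuity of the paths.

    The Fourier series of the triangular wave (cvg_odd_cos_sum),

      sum over odd o of cos (o y) / o^2 = pi / 4 (pi / 2 - y), 0 <= y <= pi,

    sums these functions with weights 4 h / (o^2 pi^2) to (h - (M - m))^+, so

      E (h - range)^+ = sum over odd o of
                          8 h / (o^2 pi^2) exp (- o^2 pi^2 T / (2 h^2)).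

    The left derivative in h of the left-hand side is P(range < h).  On the
    right-hand side the derivatives of the terms are the terms of the announced
    series, and they are at most 16 / (o^2 pi^2) whatever h is, so that the
    series may be differentiated term by term (cvg_range_cdf). *)

Set Implicit Arguments.
Unset Strict Implicit.
Unset Printing Implicit Defensive.

(** * Trigonometric estimates and series with quadratic tails *)

(** The mean value theorem, in the form used for all error terms below: a
    bound on derivatives becomes a bound on increments. *)
Lemma le_variation (R : realType) (f g df dg : R -> R) (a b : R) : a <= b ->
  (forall x, a <= x <= b -> is_derive x 1 f (df x)) ->
  (forall x, a <= x <= b -> is_derive x 1 g (dg x)) ->
  (forall x, a <= x <= b -> `|df x| <= dg x) ->
  `|f b - f a| <= g b - g a.
Proof.
move=> ab fE gE le_dfg.
have key (F dF : R -> R) : (forall x, a <= x <= b -> is_derive x 1 F (dF x)) ->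
    (forall x, a <= x <= b -> 0 <= dF x) -> F a <= F b.
  move=> FE dF0; rewrite -subr_ge0.
  have [||c] := @MVT_segment R F dF a b ab.
  - move=> x; rewrite in_itv/= => /andP[ax xb]; apply: FE.
    by rewrite !ltW.
  - apply: derivable_within_continuous => x; rewrite in_itv/= => axb.
    by have [] := FE x axb.
  - by rewrite in_itv/= => acb ->; rewrite mulr_ge0 ?dF0 ?subr_ge0.
have := key (g - f) (dg - df) _ _; have := key (g + f) (dg + df) _ _.
rewrite !fctE ler_norml => h1 h2; apply/andP; split.
  have : g a + f a <= g b + f b.
    apply: h1 => x axb; first by have := fE x axb; have := gE x axb => ? ?; exact: is_deriveD.
    by have := le_dfg x axb; rewrite ler_norml => /andP[]; lra.
  by lra.
have : g a - f a <= g b - f b.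
  apply: h2 => x axb; first by have := fE x axb; have := gE x axb => ? ?; exact: is_deriveB.
  by have := le_dfg x axb; rewrite ler_norml => /andP[]; lra.
by lra.
Qed.

Lemma norm_sin_le (R : realType) (x : R) : 0 <= x -> `|sin x| <= x.
Proof.
move=> x0; have := @le_variation R sin id cos (cst 1) 0 x x0.
rewrite sin0 !subr0; apply => *; exact: cos_max.
Qed.

(** The cosine is flat at 0.  The factor min 1 v makes the error committed at
    each new extremum of a path of second order in its step, while it stays
    bounded by the first order term. *)
Lemma cos_lipschitz_min (R : realType) (u v : R) : 0 <= u <= v ->
  `|cos v - cos u| <= (v - u) * Num.min 1 v.
Proof.
move=> /andP[u0 uv]; rewrite mulrBl.
apply: (@le_variation R cos (fun x => x * Num.min 1 v) (fun x => - sin x)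
  (fun=> Num.min 1 v) u v uv) => x /andP[ux xv].
- have -> : (fun x0 : R => x0 * Num.min 1 v) = id * cst (Num.min 1 v) by [].
  by apply: is_derive_eq; rewrite /GRing.scale/=; ring.
- rewrite normrN le_min sin_max (le_trans (norm_sin_le _))//.
  exact: le_trans ux.
Qed.

Section series_with_quadratic_tail.
Context {R : realType}.
Implicit Types (f : nat -> R) (l M : R).

(** A telescoping majorant, so that tails are estimated without knowing the
    value of the series. *)
Lemma odd_inv_sqr_le_telescope k :
  (k.*2.+1%:R ^+ 2)^-1 <= 2 / k.+1%:R - 2 / k.+2%:R :> R.
Proof.
have k1 : 0 < k.+1%:R :> R by rewrite ltr0n.
have k2 : 0 < k.+2%:R :> R by rewrite ltr0n.
have -> : 2 / k.+1%:R - 2 / k.+2%:R = 2 / (k.+1%:R * k.+2%:R) :> R.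
  by move: k2; rewrite -[in k.+2%:R]natr1 => k2; field; rewrite !gt_eqF.
rewrite ler_pdivlMr ?mulr_gt0// mulrC ler_pdivrMr ?exprn_gt0 ?ltr0n//.
have -> : k.*2.+1%:R = 2 * k%:R + 1 :> R by rewrite -addn1 natrD -muln2 natrM mulrC.
have -> : k.+1%:R = k%:R + 1 :> R by rewrite -addn1 natrD.
have -> : k.+2%:R = k%:R + 2 :> R by rewrite -addn2 natrD.
have : 0 <= k%:R :> R by [].
by nra.
Qed.

Lemma quadratic_tail f M K n : (K <= n)%N ->
  (forall k, `|f k| <= M / k.*2.+1%:R ^+ 2) ->
  `|\sum_(k < n) f k - \sum_(k < K) f k| <= 2 * M / K.+1%:R.
Proof.
move=> Kn fM; have M0 : 0 <= M.
  by have := fM 0%N; rewrite expr1n divr1; apply: le_trans.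
suff : `|\sum_(k < n) f k - \sum_(k < K) f k| <= 2 * M / K.+1%:R - 2 * M / n.+1%:R.
  move=> /le_trans; apply; rewrite lerBlDr lerDl.
  by rewrite divr_ge0// mulr_ge0.
elim: n Kn => [|n IH].
  by rewrite leqn0 => /eqP->; rewrite !subrr normr0.
rewrite leq_eqVlt => /orP[/eqP->|/IH{}IH]; first by rewrite !subrr normr0.
rewrite big_ord_recr/= addrAC (le_trans (ler_normD _ _))//.
have := fM n; have := odd_inv_sqr_le_telescope n => /(ler_wpM2l M0).
rewrite mulrBr !mulrA [M * 2]mulrC; move: IH.
move: (_ / _) (_ / _) (_ / _) (_ / _) `|_| `|_| => a b c d e g.
by lra.
Qed.

Lemma cvg_quadratic_tail f M l K :
  (forall k, `|f k| <= M / k.*2.+1%:R ^+ 2) ->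
  \sum_(k < n) f k @[n --> \oo] --> l ->
  `|l - \sum_(k < K) f k| <= 2 * M / K.+1%:R.
Proof.
move=> fM fl.
have fl' : `|\sum_(k < n) f k - \sum_(k < K) f k| @[n --> \oo] -->
    `|l - \sum_(k < K) f k|.
  by apply: cvg_norm; apply: cvgB => //; exact: cvg_cst.
rewrite -(cvg_lim _ fl')//; apply: limr_le; first by apply/cvg_ex; exists (`|l - \sum_(k < K) f k|).
by near=> n; apply: quadratic_tail => //; near: n; exact: nbhs_infty_ge.
Unshelve. all: by end_near. Qed.

(** Exchange of a limit and a series whose tails are small uniformly in n. *)
Lemma cvg_exchange_partial_sums (a : nat -> nat -> R) (b D c : nat -> R) (d : R) :
  (forall n K, `|D n - \sum_(k < K) a n k| <= c K) ->
  c K @[K --> \oo] --> 0 -> D n @[n --> \oo] --> d ->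
  (forall k, a n k @[n --> \oo] --> b k) ->
  \sum_(k < K) b k @[K --> \oo] --> d.
Proof.
move=> Dac c0 Dd ab.
have bnd K : `|d - \sum_(k < K) b k| <= c K.
  have cv : `|D n - \sum_(k < K) a n k| @[n --> \oo] --> `|d - \sum_(k < K) b k|.
    apply: cvg_norm; apply: cvgB => //.
    elim: K => [|K IH].
      by rewrite big_ord0; under eq_fun do rewrite big_ord0; exact: cvg_cst.
    rewrite big_ord_recr/=; under eq_fun do rewrite big_ord_recr/=.
    by apply: cvgD.
  rewrite -(cvg_lim _ cv)//; apply: limr_le; last exact: nearW.
  by apply/cvg_ex; exists (`|d - \sum_(k < K) b k|).
apply/cvgrPdist_le => e e0.
move/cvgrPdist_le : c0 => /(_ e e0); apply: filterS => K.
rewrite sub0r normrN; apply: le_trans; apply: le_trans (bnd K) _.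
exact: ler_norm.
Qed.

Lemma cvg_div_succ M : M / n.+1%:R @[n --> \oo] --> (0 : R).
Proof.
rewrite -(mulr0 M); apply: cvgM; first exact: cvg_cst.
exact: cvg_harmonic.
Qed.

Lemma cvg_const_div_nat M : M / n%:R @[n --> \oo] --> (0 : R).
Proof.
by rewrite -cvg_shiftS; exact: cvg_div_succ.
Qed.

End series_with_quadratic_tail.

(** * Fourier series of the triangular wave *)

Section triangular_wave.
Context {R : realType}.
Implicit Types (x y : R) (n k : nat).

Definition odd_cos_sum n x : R :=
  \sum_(k < n) cos (k.*2.+1%:R * x) / k.*2.+1%:R ^+ 2.
Definition odd_sin_sum n x : R :=
  \sum_(k < n) sin (k.*2.+1%:R * x) / k.*2.+1%:R.

(** The derivative of odd_sin_sum in closed form; its oscillation makes the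
    sine series converge. *)
Lemma dirichlet_kernel n x :
  2 * sin x * (\sum_(k < n) cos (k.*2.+1%:R * x)) = sin (n.*2%:R * x).
Proof.
elim: n => [|n IHn]; first by rewrite big_ord0 mulr0 mul0r sin0.
rewrite big_ord_recr/= mulrDr IHn.
set a := n.*2.+1%:R * x.
have -> : n.*2%:R * x = a - x by rewrite /a -[n.*2.+1]addn1 natrD; ring.
have -> : n.+1.*2%:R * x = a + x by rewrite /a doubleS -[n.*2.+2]addn1 natrD; ring.
by rewrite sinB sinD; ring.
Qed.

Lemma is_derive_odd_sin_sum n x :
  is_derive x 1 (odd_sin_sum n) (\sum_(k < n) cos (k.*2.+1%:R * x)).
Proof.
have -> : odd_sin_sum n = \sum_(k < n)
    ((k.*2.+1%:R)^-1 : R) \*: (sin \o (k.*2.+1%:R \*: (id : R -> R))).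
  apply/funext => y; rewrite fct_sumE; apply: eq_bigr => k _ /=.
  by rewrite /GRing.scale/= mulrC.
apply: is_derive_eq; apply: eq_bigr => k _.
by rewrite /GRing.scale/=; field.
Qed.

Lemma is_derive_odd_cos_sum n x :
  is_derive x 1 (odd_cos_sum n) (- odd_sin_sum n x).
Proof.
have -> : odd_cos_sum n = \sum_(k < n)
    ((k.*2.+1%:R ^+ 2)^-1 : R) \*: (cos \o (k.*2.+1%:R \*: (id : R -> R))).
  apply/funext => y; rewrite fct_sumE; apply: eq_bigr => k _ /=.
  by rewrite /GRing.scale/= mulrC.
apply: is_derive_eq; rewrite -sumrN; apply: eq_bigr => k _.
by rewrite /GRing.scale/=; field.
Qed.

(** Integration by parts of the Dirichlet kernel sin (2 n y) / (2 sin y): the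
    boundary term cos (2 n y) / (4 n sin y) is added to the sum, and what
    remains has a derivative dominated by that of - 1 / (4 n sin y). *)
Lemma odd_sin_sum_tail n x : (0 < n)%N -> 0 < x <= pi / 2 ->
  `|odd_sin_sum n (pi / 2) - odd_sin_sum n x| <= (2 * n%:R * sin x)^-1.
Proof.
move=> n0 /andP[x0 xpi].
have sin_pos y : x <= y <= pi / 2 -> 0 < sin y.
  move=> /andP[xy ypi]; rewrite sin_gt0_pi// (lt_le_trans x0 xy)/=.
  by rewrite (le_lt_trans ypi)// ltr_pdivrMr// ltr_pMr ?pi_gt0// ltr1n.
have n0' : 0 < n%:R :> R by rewrite ltr0n.
pose c : R := (4 * n%:R)^-1.
have c0 : 0 < c by rewrite invr_gt0 mulr_gt0.
pose q y := odd_sin_sum n y + c * (cos (n.*2%:R * y) / sin y).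
have dinv y : x <= y <= pi / 2 ->
    is_derive y 1 (fun z => (sin z)^-1 : R) (- (sin y) ^- 2 * cos y).
  by move=> /sin_pos siny; apply: is_deriveV; rewrite gt_eqF.
have dq y : x <= y <= pi / 2 ->
    is_derive y 1 q (- c * (cos (n.*2%:R * y) * cos y / sin y ^+ 2)).
  move=> xy; have siny := sin_pos y xy; have ? := dinv y xy.
  have ? := is_derive_odd_sin_sum n y.
  have -> : q = odd_sin_sum n +
      c \*: ((cos \o (n.*2%:R \*: (id : R -> R))) * (fun z => (sin z)^-1)) by [].
  apply: is_derive_eq; rewrite /GRing.scale/=.
  have -> : \sum_(k < n) cos (k.*2.+1%:R * y) = sin (n.*2%:R * y) / (2 * sin y).
    by rewrite -dirichlet_kernel mulrAC mulfV ?mul1r// mulf_neq0 ?gt_eqF.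
  rewrite -[n.*2]muln2 natrM /c; field.
  by rewrite !gt_eqF.
have dg y : x <= y <= pi / 2 ->
    is_derive y 1 (fun z => - c * (sin z)^-1) (c * (cos y / sin y ^+ 2)).
  move=> xy; have siny := sin_pos y xy; have ? := dinv y xy.
  have -> : (fun z => - c * (sin z)^-1) = (- c) \*: (fun z => (sin z)^-1) by [].
  apply: is_derive_eq; rewrite /GRing.scale/=; field.
  by rewrite gt_eqF.
have bnd y : x <= y <= pi / 2 ->
    `|- c * (cos (n.*2%:R * y) * cos y / sin y ^+ 2)| <= c * (cos y / sin y ^+ 2).
  move=> xy; have siny := sin_pos y xy.
  rewrite !normrM normrN (gtr0_norm c0) -mulrA ler_wpM2l ?(ltW c0)//.
  rewrite normfV [`|sin y ^+ 2|]ger0_norm ?sqr_ge0// mulrA.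
  rewrite ler_wpM2r ?invr_ge0 ?sqr_ge0//.
  have cosy : 0 <= cos y.
    apply: cos_ge0_pihalf; case/andP: xy => xy ->; rewrite andbT.
    by rewrite (le_trans _ (le_trans (ltW x0) xy))// oppr_le0 divr_ge0 ?pi_ge0.
  by rewrite (ger0_norm cosy) ler_piMl// cos_max.
have := le_variation xpi dq dg bnd.
rewrite /q sin_pihalf invr1 !mulr1.
set A := odd_sin_sum _ _; set B := odd_sin_sum _ _.
set u := cos (_ * (pi / 2)); set v := cos _.
have -> : (2 * n%:R * sin x)^-1 = 2 * (c / sin x).
  by rewrite /c; field; rewrite !gt_eqF ?sin_pos ?lexx.
have u1 : `|c * u| <= c by rewrite normrM gtr0_norm// ler_piMr ?(ltW c0)// cos_max.
have v1 : `|c * (v / sin x)| <= c / sin x.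
  have sinx : 0 < sin x by rewrite sin_pos ?lexx.
  rewrite mulrA mulrAC normrM gtr0_norm ?divr_gt0// ler_piMr ?cos_max//.
  by rewrite divr_ge0 ?ltW.
move: u1 v1; rewrite !ler_norml => /andP[u1 u2] /andP[v1 v2] /andP[h1 h2].
by apply/andP; split; lra.
Qed.

Lemma odd_sin_sum_pihalf n :
  odd_sin_sum n (pi / 2) = \sum_(k < n) (-1) ^+ k / k.*2.+1%:R.
Proof.
apply: eq_bigr => k _; congr (_ / _).
have -> : k.*2.+1%:R * (pi / 2) = pi / 2 + pi *+ k :> R.
  by rewrite -addn1 natrD -muln2 natrM -[pi *+ k]mulr_natl; field.
by rewrite (alternatingn (@sinDpi R)) sin_pihalf mulr1.
Qed.

(** The partial sums of the arctangent series at 1: the derivative of the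
    error is a geometric remainder. *)
Lemma leibniz_series n :
  `|odd_sin_sum n (pi / 2) - pi / 4| <= (n.*2.+1%:R)^-1.
Proof.
rewrite odd_sin_sum_pihalf.
pose f (x : R) := \sum_(k < n) (-1) ^+ k / k.*2.+1%:R * x ^+ k.*2.+1 - atan x.
have oneDsqr_gt0 (x : R) : 0 < 1 + x ^+ 2.
  by rewrite ltr_pwDl// sqr_ge0.
have geom (x : R) : (\sum_(k < n) (-1) ^+ k * x ^+ k.*2) * (1 + x ^+ 2) =
    1 - (-1) ^+ n * x ^+ n.*2.
  elim: (n) => [|m IH]; first by rewrite big_ord0 mul0r !expr0 mulr1 subrr.
  by rewrite big_ord_recr/= mulrDl IH doubleS !exprS; ring.
have df (x : R) : 0 <= x <= 1 ->
    is_derive x 1 f (- ((-1) ^+ n * x ^+ n.*2 / (1 + x ^+ 2))).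
  move=> _.
  have -> : f = \sum_(k < n) ((-1) ^+ k / k.*2.+1%:R : R) \*: ((id : R -> R) ^+ k.*2.+1)
      - atan by apply/funext => y; rewrite /f [in RHS]fctE fct_sumE; congr (_ - _); apply: eq_bigr => k _; rewrite /GRing.scale/= fctE.
  apply: is_derive_eq; rewrite /GRing.scale/=.
  have -> : (-1) ^+ n * x ^+ n.*2 = 1 - (\sum_(k < n) (-1) ^+ k * x ^+ k.*2) * (1 + x ^+ 2).
    by rewrite geom; ring.
  rewrite [in RHS]mulrBl mulfK ?gt_eqF// opprB mul1r; congr (_ - _).
  by apply: eq_bigr => k _; field.
have dg (x : R) : 0 <= x <= 1 -> is_derive x 1 (fun y => y ^+ n.*2.+1 / n.*2.+1%:R) (x ^+ n.*2).
  move=> _.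
  have -> : (fun y : R => y ^+ n.*2.+1 / n.*2.+1%:R) = (n.*2.+1%:R)^-1 \*: (id : R -> R) ^+ n.*2.+1.
    by apply/funext => y; rewrite /GRing.scale/= fctE mulrC.
  by apply: is_derive_eq; rewrite /GRing.scale/=; field.
have bnd (x : R) : 0 <= x <= 1 -> `|- ((-1) ^+ n * x ^+ n.*2 / (1 + x ^+ 2))| <= x ^+ n.*2.
  move=> /andP[x0 _]; rewrite normrN -mulrA normrMsign normrM.
  rewrite !ger0_norm ?invr_ge0 ?exprn_ge0 ?(ltW (oneDsqr_gt0 x))//.
  by rewrite ler_piMr ?exprn_ge0// invf_le1// lerDl sqr_ge0.
have := le_variation ler01 df dg bnd.
rewrite /f atan1 atan0 expr1n mul1r !expr0n/= !mul0r !subr0.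
rewrite [X in _ - X]big1 ?subr0//; last by move=> k _; rewrite expr0n/= mulr0.
by under eq_bigr do rewrite expr1n mulr1.
Qed.

(** Since the derivative of odd_cos_sum is minus odd_sin_sum, which is close
    to pi / 4 by the two previous lemmas, and since both sides vanish at
    pi / 2, the cosine sum is close to an affine function. *)
Lemma odd_cos_sum_error n x : (0 < n)%N -> 0 < x <= pi / 2 ->
  `|odd_cos_sum n x - pi / 4 * (pi / 2 - x)| <= pi / (2 * n%:R * sin x).
Proof.
move=> n0 xpi; have [x0 xle] := andP xpi.
have n0' : 0 < n%:R :> R by rewrite ltr0n.
have pi0 : 0 < pi :> R by exact: pi_gt0.
have sin_pos y : x <= y <= pi / 2 -> 0 < sin y.
  move=> /andP[xy ypi]; rewrite sin_gt0_pi// (lt_le_trans x0 xy)/=.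
  by rewrite (le_lt_trans ypi)// ltr_pdivrMr// ltr_pMr ?pi_gt0// ltr1n.
have sinx : 0 < sin x by rewrite sin_pos// lexx.
have ltpi : - (pi / 2) <= x.
  by rewrite (le_trans _ (ltW x0))// oppr_le0 divr_ge0// ltW.
have sin_le y : x <= y <= pi / 2 -> sin x <= sin y.
  move=> /andP[xy ypi]; rewrite leNgt ltr_sin -?leNgt// in_itv/= ?ypi ?xle ?ltpi//.
  by rewrite (le_trans ltpi).
pose e := (n%:R * sin x)^-1.
have df y : x <= y <= pi / 2 ->
    is_derive y 1 (fun z => odd_cos_sum n z + pi / 4 * z) (- odd_sin_sum n y + pi / 4).
  move=> _; have ? := is_derive_odd_cos_sum n y.
  have -> : (fun z => odd_cos_sum n z + pi / 4 * z) =
    odd_cos_sum n + (pi / 4) \*: (id : R -> R) by [].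
  by apply: is_derive_eq; rewrite /GRing.scale/= mulr1.
have dg y : x <= y <= pi / 2 -> is_derive y 1 (fun z => e * z) e.
  move=> _; have -> : (fun z => e * z) = e \*: (id : R -> R) by [].
  by apply: is_derive_eq; rewrite /GRing.scale/= mulr1.
have bnd y : x <= y <= pi / 2 -> `|- odd_sin_sum n y + pi / 4| <= e.
  move=> xy; have siny := sin_pos y xy.
  have /andP[xy1 xy2] := xy.
  have h1 : `|odd_sin_sum n (pi / 2) - odd_sin_sum n y| <= (2 * n%:R * sin y)^-1.
    by apply: odd_sin_sum_tail => //; rewrite (lt_le_trans x0).
  have h2 := leibniz_series n.
  have h3 : (2 * n%:R * sin y)^-1 <= e / 2.
    rewrite -[_ / 2]invfM lef_pV2 ?posrE ?mulr_gt0//.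
    rewrite [leLHS]mulrC mulrA ler_wpM2l ?sin_le ?mulr_ge0//.
  have h4 : (n.*2.+1%:R)^-1 <= e / 2 :> R.
    rewrite -[_ / 2]invfM lef_pV2 ?posrE ?mulr_gt0 ?ltr0n//.
    rewrite -[n.*2.+1]addn1 natrD -muln2 natrM [leLHS]mulrAC.
    have : n%:R * 2 * sin x <= n%:R * 2 * 1.
      by rewrite ler_wpM2l ?mulr_ge0 ?sin_le1// ltW.
    by lra.
  have aux (a b c d f g : R) : `|a - b| <= c -> `|a - d| <= f -> c <= g / 2 ->
      f <= g / 2 -> `|- b + d| <= g.
    clear; rewrite !ler_norml => /andP[? ?] /andP[? ?] ? ?.
    by apply/andP; split; lra.
  exact: aux h1 h2 h3 h4.
have := le_variation xle df dg bnd.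
have -> : odd_cos_sum n (pi / 2) = 0.
  apply: big1 => k _.
  have -> : k.*2.+1%:R * (pi / 2) = pi / 2 + pi *+ k :> R.
    by rewrite -addn1 natrD -muln2 natrM -[pi *+ k]mulr_natl; field.
  by rewrite (alternatingn (@cosDpi R)) cos_pihalf mulr0 mul0r.
rewrite add0r -normrN opprB => h.
rewrite (_ : _ - _ = odd_cos_sum n x + pi / 4 * x - pi / 4 * (pi / 2)); last by ring.
apply: (le_trans h); rewrite -mulrBr.
have -> : pi / (2 * n%:R * sin x) = e * (pi / 2) by rewrite /e; field; rewrite !gt_eqF.
by rewrite ler_wpM2l ?invr_ge0 ?mulr_ge0 ?(ltW n0') ?(ltW sinx)// lerBlDr lerDl ltW.
Qed.

Lemma odd_cos_sum_term_le k x :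
  `|cos (k.*2.+1%:R * x) / k.*2.+1%:R ^+ 2| <= 1 / k.*2.+1%:R ^+ 2.
Proof.
rewrite normrM [X in _ * X]ger0_norm ?invr_ge0 ?sqr_ge0//.
by rewrite ler_wpM2r ?invr_ge0 ?sqr_ge0// cos_max.
Qed.

(** The error estimate degenerates at 0, which is reached along y_m -> 0 with
    tails that are uniform in y; the points beyond pi / 2 follow from the
    symmetry x -> pi - x. *)
Lemma cvg_odd_cos_sum x : 0 <= x <= pi ->
  odd_cos_sum n x @[n --> \oo] --> pi / 4 * (pi / 2 - x).
Proof.
have pi0 : 0 < pi :> R by exact: pi_gt0.
have pos y : 0 < y <= pi / 2 ->
    odd_cos_sum n y @[n --> \oo] --> pi / 4 * (pi / 2 - y).
  move=> ypi; have [y0 yle] := andP ypi.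
  have siny : 0 < sin y.
    by rewrite sin_gt0_pi// y0 (le_lt_trans yle)// ltr_pdivrMr// ltr_pMr// ltr1n.
  apply/cvgrPdist_le => e e0.
  have := @cvg_const_div_nat R (pi / (2 * sin y)).
  move/cvgrPdist_le => /(_ e e0); apply: filter_app; near=> n.
  rewrite sub0r normrN => h; rewrite distrC.
  have n0 : (0 < n)%N by near: n; exact: nbhs_infty_gt.
  apply: le_trans (odd_cos_sum_error n0 ypi) _; apply: le_trans h.
  apply: le_trans (ler_norm _); rewrite le_eqVlt; apply/orP; left; apply/eqP.
  by field; rewrite !gt_eqF// ltr0n.
have zero : odd_cos_sum n 0 @[n --> \oo] --> pi / 4 * (pi / 2 - 0).
  pose y m : R := (pi / 2) / m.+1%:R.
  have ypi m : 0 < y m <= pi / 2.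
    rewrite divr_gt0 ?divr_gt0 ?ltr0n//= ler_pdivrMr ?ltr0n// ler_peMr ?ler1n//.
    by rewrite divr_ge0 ?ltW.
  have ycvg : y m @[m --> \oo] --> (0 : R) by exact: cvg_div_succ.
  apply: (@cvg_exchange_partial_sums R
    (fun m k => cos (k.*2.+1%:R * y m) / k.*2.+1%:R ^+ 2)
    (fun k => cos (k.*2.+1%:R * 0) / k.*2.+1%:R ^+ 2)
    (fun m => pi / 4 * (pi / 2 - y m)) (fun K => 2 * 1 / K.+1%:R)).
  - move=> m K; apply: (@cvg_quadratic_tail R (fun k => cos (k.*2.+1%:R * y m) / k.*2.+1%:R ^+ 2)); last exact: pos.
    by move=> k; exact: odd_cos_sum_term_le.
  - exact: cvg_div_succ.
  - by apply: cvgM; [exact: cvg_cst|apply: cvgB => //; exact: cvg_cst].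
  - move=> k; apply: cvgM; last exact: cvg_cst.
    apply: continuous_cvg; first exact: continuous_cos.
    by apply: cvgM => //; exact: cvg_cst.
move=> /andP[x0 xpi].
have [xle|xgt] := leP x (pi / 2).
  move: x0; rewrite le_eqVlt => /predU1P[<-//|x0].
  by apply: pos; rewrite x0.
have -> : pi / 4 * (pi / 2 - x) = - (pi / 4 * (pi / 2 - (pi - x))) by field.
have -> : odd_cos_sum ^~ x = (fun n => - odd_cos_sum n (pi - x)).
  apply/funext => n; rewrite /odd_cos_sum -sumrN; apply: eq_bigr => k _.
  have -> : k.*2.+1%:R * (pi - x) = - (k.*2.+1%:R * x) + pi + pi *+ k.*2.
    rewrite -[k.*2.+1]addn1 natrD -[pi *+ _]mulr_natl; ring.
  rewrite (alternatingn (@cosDpi R)) -signr_odd odd_double expr0 mul1r cosDpi cosN.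
  by rewrite mulNr opprK.
apply: cvgN; have [xlt|] := ltP x pi.
  by apply: pos; lra.
by move=> pix; have -> : pi - x = 0 by lra.
Unshelve. all: by end_near. Qed.

End triangular_wave.

(** * Characteristic function of the normal law *)

Section real_valued_convergence.
Context d (T : measurableType d) (R : realType) (mu : {measure set T -> \bar R}).

Lemma Rintegral_dominated_cvg (f_ : nat -> T -> R) (f g : T -> R) :
  (forall n, measurable_fun setT (f_ n)) ->
  (forall x, f_ n x @[n --> \oo] --> f x) ->
  mu.-integrable setT (EFin \o g) ->
  (forall n x, `|f_ n x| <= g x) ->
  (\int[mu]_x f_ n x)%R @[n --> \oo] --> (\int[mu]_x f x)%R.
Proof.
move=> mf_ f_f ig f_g.
have mf : measurable_fun setT f by apply: measurable_fun_cvg => // x _; exact: f_f.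
have f_fE : forall x, setT x -> (fun n => (f_ n x)%:E) @ \oo --> (f x)%:E.
  by move=> x _; apply/fine_cvgP; split; [exact: nearW|exact: f_f].
have [intf _] := @dominated_convergence _ _ _ mu _ measurableT
  (fun n => EFin \o f_ n) (EFin \o f) (EFin \o g)
  (fun n => (measurable_EFinP _ _).2 (mf_ n)) ((measurable_EFinP _ _).2 mf)
  (aeW _ f_fE) ig
  (aeW _ (fun x n _ => f_g n x : (`|(f_ n x)%:E| <= (g x)%:E)%E)).
move=> /= h; apply: fine_cvg; rewrite fineK//.
exact: integrable_fin_num.
Qed.

End real_valued_convergence.

Section gaussian_characteristic_function.
Context {R : realType}.
Variable s : R.
Hypothesis s0 : 0 < s.
Local Notation mu := (@lebesgue_measure R).
Local Notation phi := (normal_pdf 0 s).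
Implicit Types (x y k : R) (n : nat).

Let s_neq0 : s != 0. Proof. by rewrite gt_eqF. Qed.

Let phiE x : phi x = normal_peak s * expR (- x ^+ 2 / (s ^+ 2 *+ 2)).
Proof. by rewrite normal_pdfE// /normal_fun subr0. Qed.

Lemma normal_pdfN x : phi (- x) = phi x.
Proof. by rewrite !phiE sqrrN. Qed.

Lemma is_derive_normal_pdf x : is_derive x 1 phi (- (x / s ^+ 2) * phi x).
Proof.
have -> : phi = normal_peak s \*: (expR \o ((- (s ^+ 2 *+ 2)^-1) \*: ((id : R -> R) ^+ 2))).
  apply/funext => y; rewrite fctE phiE /GRing.scale/=.
  by congr (_ * expR _); rewrite fctE [RHS]mulrC mulrN mulNr.
apply: is_derive_eq; rewrite !fctE /GRing.scale/=; rewrite /GRing.scale/=; field.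
by rewrite s_neq0.
Qed.

Let mass1 : R := normal_peak s * s / normal_peak (s * Num.sqrt 2).

(** The factor |x| is paid for by doubling the variance, so that first
    moments are dominated by a normal density. *)
Lemma normal_pdf_moment_le x :
  `|x * phi x| <= mass1 * normal_pdf 0 (s * Num.sqrt 2) x.
Proof.
have s2 : s * Num.sqrt 2 != 0 by rewrite mulf_neq0// gt_eqF// sqrtr_gt0.
rewrite normrM (ger0_norm (normal_pdf_ge0 _ _ _)) phiE normal_pdfE//.
rewrite /normal_fun subr0 /mass1.
have -> : normal_peak s * s / normal_peak (s * Num.sqrt 2) *
    (normal_peak (s * Num.sqrt 2) * expR (- x ^+ 2 / ((s * Num.sqrt 2) ^+ 2 *+ 2))) =
    normal_peak s * (s * expR (- x ^+ 2 / ((s * Num.sqrt 2) ^+ 2 *+ 2))).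
  by field; rewrite gt_eqF// normal_peak_gt0.
rewrite mulrCA ler_wpM2l ?normal_peak_ge0//.
rewrite exprMn sqr_sqrtr//.
set a := (X in s * expR X); rewrite [X in expR X](_ : _ = a + a); last first.
  by rewrite /a; field.
rewrite expRD mulrA ler_wpM2r ?expR_ge0//.
rewrite -[expR a]invrK -expRN ler_pdivrMr ?expR_gt0//.
apply: (@le_trans _ _ (s * (1 + - a))); last first.
  by rewrite ler_wpM2l ?(ltW s0)// expR_ge1Dx.
have -> : 1 + - a = 1 + (`|x| / s) ^+ 2 / 4.
  by rewrite expr_div_n real_normK ?num_real// /a; field.
rewrite -ler_pdivrMl// mulrC; set t := `|x| / s.
by have := sqr_ge0 (t - 2); rewrite sqrrB; lra.
Qed.

Lemma normal_pdf_moment_bounded x :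
  `|x * phi x| <= mass1 * normal_peak (s * Num.sqrt 2).
Proof.
apply: le_trans (normal_pdf_moment_le x) _; rewrite ler_wpM2l//.
  by rewrite divr_ge0 ?mulr_ge0 ?normal_peak_ge0 ?ltW.
by apply: normal_pdf_ub; rewrite mulf_neq0// gt_eqF// sqrtr_gt0.
Qed.

Let integrable_moment : mu.-integrable setT (fun x => (`|x * phi x|)%:E).
Proof.
apply: (@le_integrable _ _ _ mu setT measurableT _
    (fun x => (mass1 * normal_pdf 0 (s * Num.sqrt 2) x)%:E)).
- apply/measurable_EFinP; apply: measurableT_comp => //.
  by apply: measurable_funM => //; exact: measurable_normal_pdf.
- move=> x _ /=; rewrite normr_id lee_fin [leRHS]ger0_norm ?normal_pdf_moment_le//.
  exact: (le_trans (normr_ge0 _) (normal_pdf_moment_le x)).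
- under eq_fun do rewrite EFinM.
  by apply: integrableZl => //; exact: integrable_normal_pdf.
Qed.

Let integrable_dom (g : R -> R) (C : R) : measurable_fun setT g ->
  (forall x, `|g x| <= C * phi x) -> mu.-integrable setT (EFin \o g).
Proof.
move=> mg gC; apply: (@le_integrable _ _ _ mu setT measurableT _
    (fun x => (C * phi x)%:E)).
- exact/measurable_EFinP.
- move=> x _ /=; rewrite lee_fin (le_trans (gC x))// ler_norm//.
- under eq_fun do rewrite EFinM.
  by apply: integrableZl => //; exact: integrable_normal_pdf.
Qed.

Let measurable_trig (h : R -> R) k : continuous h ->
  measurable_fun setT (fun x : R => h (k * x)).
Proof.
move=> ch; apply: measurableT_comp; last exact: measurable_funM.
exact: continuous_measurable_fun.
Qed.

Let integrable_cos k : mu.-integrable setT (EFin \o (fun x => cos (k * x) * phi x)).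
Proof.
apply: (integrable_dom (C := 1)).
  apply: measurable_funM; last exact: measurable_normal_pdf.
  by apply: measurable_trig; exact: continuous_cos.
move=> x; rewrite normrM (ger0_norm (normal_pdf_ge0 _ _ _)).
by rewrite ler_wpM2r ?normal_pdf_ge0 ?cos_max.
Qed.

Let measurable_xsin k : measurable_fun setT (fun x => sin (k * x) * (x * phi x)).
Proof.
apply: measurable_funM.
  by apply: measurable_trig; exact: continuous_sin.
by apply: measurable_funM => //; exact: measurable_normal_pdf.
Qed.

Let integrable_xsin k : mu.-integrable setT (EFin \o (fun x => sin (k * x) * (x * phi x))).
Proof.
apply: (le_integrable _ _ _ integrable_moment) => //.
  by apply/measurable_EFinP; exact: measurable_xsin.
move=> x _ /=; rewrite lee_fin normr_id normrM ler_piMl// sin_max//.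
Qed.

(** Integration by parts against the normal density: the integrand
    k cos (k x) phi(x) - s^-2 sin (k x) x phi(x) is the derivative of
    sin (k x) phi(x), which vanishes at infinity. *)
Lemma normal_stein_sin k :
  (\int[mu]_x (sin (k * x) * (x * phi x)))%R =
  s ^+ 2 * k * (\int[mu]_x (cos (k * x) * phi x))%R.
Proof.
pose H x := sin (k * x) * phi x.
pose h x := k * (cos (k * x) * phi x) - (s ^+ 2)^-1 * (sin (k * x) * (x * phi x)).
have dH x : is_derive x 1 H (h x).
  have ? := is_derive_normal_pdf x.
  have -> : H = (sin \o (k \*: (id : R -> R))) * phi by [].
  by apply: is_derive_eq; rewrite /GRing.scale/= /h; field.
have ih : mu.-integrable setT (EFin \o h).
  have -> : EFin \o h = ((fun x => k%:E * (cos (k * x) * phi x)%:E) \-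
     (fun x => ((s ^+ 2)^-1)%:E * (sin (k * x) * (x * phi x))%:E))%E.
    by apply/funext => x /=; rewrite EFinB !EFinM.
  apply: integrableB => //; apply: integrableZl => //.
  - exact: integrable_cos.
  - exact: integrable_xsin.
have cH : continuous H.
  move=> x; apply: differentiable_continuous; apply/derivable1_diffP.
  by have [] := dH x.
have ch : continuous h.
  move=> x; apply: differentiable_continuous.
  apply/derivable1_diffP; have ? := is_derive_normal_pdf x.
  have -> : h = k \*: ((cos \o (k \*: (id : R -> R))) * phi) -
    (s ^+ 2)^-1 \*: ((sin \o (k \*: (id : R -> R))) * ((id : R -> R) * phi)) by [].
  exact: ex_derive.
have hE : (\int[mu]_x h x)%R = 0.
  have cvg1 : (\int[mu]_(x in `[- n.+1%:R, n.+1%:R]) h x)%R @[n --> \oo] -->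
      (\int[mu]_x h x)%R.
    have -> : (fun n => \int[mu]_(x in `[- n.+1%:R, n.+1%:R]) h x)%R =
        (fun n => \int[mu]_x (h \_ `[- n.+1%:R, n.+1%:R]) x)%R.
      by apply/funext => n; rewrite Rintegral_mkcond.
    apply: (@Rintegral_dominated_cvg _ _ _ mu _ _ (fun x => `|h x|)).
    - move=> n; apply/(measurable_restrictT _ _).1 => //.
      by apply: measurable_funTS; exact: continuous_measurable_fun.
    - move=> x; apply: cvg_near_cst; near=> n; rewrite patchE mem_set//=.
      have : `|x| <= n.+1%:R.
        apply: (@le_trans _ _ n%:R); last by rewrite ler_nat.
        by near: n; exact: nbhs_infty_ger.
      by rewrite in_itv/= ler_norml.
    - exact: integrable_norm.
    - move=> n x; rewrite patchE; case: ifPn => //= _.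
      by rewrite normr0.
  pose C := 2 * (mass1 * normal_peak (s * Num.sqrt 2)).
  have cvg0 : (\int[mu]_(x in `[- n.+1%:R, n.+1%:R]) h x)%R @[n --> \oo] --> (0 : R).
    have -> : (fun n => \int[mu]_(x in `[- n.+1%:R, n.+1%:R]) h x)%R =
        (fun n => 2 * H n.+1%:R).
      apply/funext => n; rewrite /Rintegral (@continuous_FTC2 _ h H)//=.
      - by rewrite /H mulrN sinN normal_pdfN; ring.
      - by rewrite gtrN.
      - exact: continuous_subspaceT.
      - split.
        + by move=> x _; have [] := dH x.
        + by apply: cvg_at_right_filter; exact: cH.
        + by apply: cvg_at_left_filter; exact: cH.
      - by move=> x _; rewrite derive1E; have [] := dH x.
    apply: (@squeeze_cvgr _ _ _ _ (fun n => - (C / n.+1%:R)) (fun n => C / n.+1%:R)).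
    - apply: nearW => n; rewrite -ler_norml /C normrM ger0_norm//.
      rewrite -mulrA ler_wpM2l// ler_pdivlMr ?ltr0n//.
      have -> : `|H n.+1%:R| * n.+1%:R = `|sin (k * n.+1%:R)| * `|n.+1%:R * phi n.+1%:R|.
        by rewrite !normrM [`|n.+1%:R|]ger0_norm//; ring.
      apply: le_trans (normal_pdf_moment_bounded n.+1%:R).
      by rewrite ler_piMl// sin_max.
    - rewrite -oppr0; apply: cvgN; exact: cvg_div_succ.
    - exact: cvg_div_succ.
  exact: (cvg_unique (@norm_hausdorff _ _) cvg1 cvg0).
have : (\int[mu]_x h x)%R = k * (\int[mu]_x (cos (k * x) * phi x))%R -
   (s ^+ 2)^-1 * (\int[mu]_x (sin (k * x) * (x * phi x)))%R.
  rewrite /h RintegralB//; last 2 first.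
    rewrite /comp; under eq_fun do rewrite EFinM.
    by apply: integrableZl => //; exact: integrable_cos.
    rewrite /comp; under eq_fun do rewrite EFinM.
    by apply: integrableZl => //; exact: integrable_xsin.
  by rewrite !RintegralZl//.
rewrite hE => /esym/eqP; rewrite subr_eq0 => /eqP e.
by rewrite -mulrA e mulrA divff ?mul1r// expf_neq0.
Unshelve. all: by end_near. Qed.

(** By the previous identity the integral F(k) solves F' = - s^2 k F, with
    F(0) = 1. *)
Lemma normal_integral_cos k :
  (\int[mu]_x (cos (k * x) * phi x))%R = expR (- (k ^+ 2 * s ^+ 2 / 2)).
Proof.
pose F k := (\int[mu]_x (cos (k * x) * phi x))%R.
have dF (a : R) : is_derive a 1 F (- (s ^+ 2 * a) * F a).
  have d1 (b y : R) : is_derive b 1 (fun k => cos (k * y) * phi y) (- (sin (b * y) * (y * phi y))).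
    have -> : (fun k => cos (k * y) * phi y) = phi y \*: (cos \o (y \*: (id : R -> R))).
      by apply/funext => z; rewrite /GRing.scale/= mulrC [z * _]mulrC.
    by apply: is_derive_eq; rewrite /GRing.scale/= /GRing.scale/= (mulrC y b); ring.
  have ab : a \in `](a - 1), (a + 1)[ by rewrite in_itv/=; apply/andP; split; lra.
  have bnd (b y : R) : b \in `](a - 1), (a + 1)[ -> setT y ->
      `|partial1of2 (fun k x => cos (k * x) * phi x) b y| <= `|y * phi y|.
    move=> _ _; rewrite partial1of2E; have [_ ->] := d1 b y.
    by rewrite normrN normrM ler_piMl// sin_max.
  have dd : derivable F a 1.
    apply: (@derivable_under_integral _ _ _ mu (fun k x => cos (k * x) * phi x)
      setT measurableT a (a - 1) (a + 1) ab _ _ (fun y => `|y * phi y|) _ _ bnd) => //.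
  apply: DeriveDef => //; rewrite -derive1E.
  rewrite (@differentiation_under_integral _ _ _ mu (fun k x => cos (k * x) * phi x)
    setT measurableT a (a - 1) (a + 1) ab _ _ (fun y => `|y * phi y|) _ _ bnd) => //.
  rewrite mulNr -normal_stein_sin -mulN1r -RintegralZl//.
  apply: eq_Rintegral => y _; rewrite partial1of2E; have [_ ->] := d1 a y.
  by rewrite mulN1r.
pose G k := F k * expR (k ^+ 2 * s ^+ 2 / 2).
have dG (a : R) : is_derive a 1 G 0.
  have ? := dF a.
  have -> : G = F * (expR \o ((s ^+ 2 / 2) \*: ((id : R -> R) ^+ 2))).
    apply/funext => z; rewrite !fctE /G; congr (_ * expR _).
    rewrite /GRing.scale/=.
    by rewrite /GRing.scale/=; ring.
  by apply: is_derive_eq; rewrite !fctE /GRing.scale/=; rewrite /GRing.scale/=; field.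
have G0 : G 0 = 1.
  rewrite /G expr0n/= !mul0r expR0 mulr1 /F.
  under eq_Rintegral do rewrite mul0r cos0 mul1r.
  by rewrite /Rintegral integral_normal_pdf.
have : G k = 1.
  by rewrite -G0; apply: is_derive_0_is_cst => x; exact: dG.
rewrite /G -/(F k) expRN => h; apply: (mulIf (lt0r_neq0 (expR_gt0 (k ^+ 2 * s ^+ 2 / 2)))).
by rewrite h mulVf// gt_eqF// expR_gt0.
Qed.

End gaussian_characteristic_function.

Section normal_law.
Context d (Omega : measurableType d) (R : realType) (P : probability Omega R).
Local Notation mu := (@lebesgue_measure R).

Lemma normal_probN (s : R) (A : set R) : s != 0 -> measurable A ->
  normal_prob 0 s (-%R @^-1` A) = normal_prob 0 s A.
Proof.
move=> s0 mA; rewrite /normal_prob.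
have mN : measurable_fun setT (-%R : R -> measurableTypeR R) by exact: oppr_measurable.
transitivity (\int[pushforward mu (-%R : R -> measurableTypeR R)]_(x in A)
    (normal_pdf 0 s x)%:E)%E.
  rewrite ge0_integral_pushforward//.
  - apply: eq_integral => x _ /=; rewrite normal_pdfE// /normal_fun !subr0 sqrrN//.
  - by apply/measurable_EFinP; apply: measurable_funTS; exact: measurable_normal_pdf.
  - by move=> x; rewrite lee_fin normal_pdf_ge0.
by apply: eq_measure_integral => //= B mB BA; exact: lebesgue_measureN.
Qed.

(** The density is a Radon-Nikodym derivative, almost everywhere. *)
Lemma integral_normal_prob (s : R) (f : R -> R) : measurable_fun setT f ->
  (normal_prob 0 s).-integrable setT (EFin \o f) ->
  (\int[normal_prob 0 s]_x (f x)%:E = \int[mu]_x (f x * normal_pdf 0 s x)%:E)%E.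
Proof.
move=> mf intf.
rewrite -(Radon_Nikodym_change_of_variables (normal_prob_dominates 0 s))//=.
apply: ae_eq_integral => //.
- apply: emeasurable_funM; first exact/measurable_EFinP.
  apply: (measurable_int mu); apply: Radon_Nikodym_integrable.
  exact: normal_prob_dominates.
- by apply/measurable_EFinP; apply: measurable_funM => //; exact: measurable_normal_pdf.
- under [X in ae_eq _ _ _ X]eq_fun do rewrite EFinM.
  apply: ae_eqe_mul2l => /=.
  rewrite Radon_NikodymE//=; first exact: normal_prob_dominates.
  move=> dom; case: cid => /= h [h1 h2 h3].
  apply: integral_ae_eq => //=.
  + by apply/measurable_EFinP; exact: measurable_normal_pdf.
  + by move=> E _ mE; rewrite -h3.
Qed.

Lemma bounded_integrable (f : Omega -> R) (M : R) : measurable_fun setT f ->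
  (forall w, `|f w| <= M) -> P.-integrable setT (EFin \o f).
Proof.
move=> mf fM; apply: measurable_bounded_integrable => //.
  by rewrite (@le_lt_trans _ _ 1%E)// ?probability_le1// ltry.
exists M; split; first exact: num_real.
by move=> r Mr x _; exact: le_trans (fM x) (ltW Mr).
Qed.

Lemma expectation_cos_normal (X : {RV P >-> R}) (s k : R) : 0 < s ->
  (forall A, measurable A -> distribution P X A = normal_prob 0 s A) ->
  (\int[P]_w cos (k * X w))%R = expR (- (k ^+ 2 * s ^+ 2 / 2)).
Proof.
move=> s0 XE.
have mc : measurable_fun setT (fun x : R => cos (k * x)).
  apply: measurableT_comp; last exact: measurable_funM.
  by apply: continuous_measurable_fun; exact: continuous_cos.
have mX : measurable_fun setT (fun w => cos (k * X w)).
  exact: (measurableT_comp mc).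
rewrite -(normal_integral_cos s0) /Rintegral; congr fine.
rewrite -integral_normal_prob//.
  (* Normal laws live on the Borel sets of measurableTypeR R, which is not the
     measurable structure used for random variables: X is read as a map into
     the former. *)
  pose Y : Omega -> measurableTypeR R := X.
  have mY : measurable_fun setT Y.
    by move=> mT A mA; exact: (@measurable_funPT _ _ _ _ X mT A mA).
  transitivity (\int[pushforward P Y]_x (cos (k * x))%:E)%E.
    rewrite (@integral_pushforward _ _ _ _ _ Y mY)//.
      exact/measurable_EFinP.
    by apply: (@bounded_integrable _ 1) => // w; exact: cos_max.
  by apply: eq_measure_integral => A mA _; exact: XE.
apply: measurable_bounded_integrable => //.
  by rewrite (@le_lt_trans _ _ 1%E)// ?probability_le1// ltry.
exists 1; split; first exact: num_real.
by move=> r Mr x _; exact: le_trans (cos_max _) (ltW Mr).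
Qed.

End normal_law.

(** * Symmetry of independent increments under sign flips *)

Section sign_flips.
Context d (Omega : measurableType d) (R : realType) (P : probability Omega R).
Variables (n : nat) (X : 'I_n -> {RV P >-> R}).

Lemma measurable_tuple_of (Y : 'I_n -> Omega -> R) :
  (forall i, measurable_fun setT (Y i)) ->
  measurable_fun setT (fun w => [tuple Y i w | i < n]).
Proof.
move=> mY; apply/measurable_fun_tnthP => i.
by rewrite (_ : _ \o _ = Y i)//; apply/funext => w /=; rewrite tnth_mktuple.
Qed.

Definition flip (b : pred 'I_n) (i : 'I_n) (w : Omega) : R :=
  if b i then - X i w else X i w.

Lemma measurable_flip b i : measurable_fun setT (flip b i).
Proof.
rewrite /flip; case: (b i); last exact: measurable_funPT.
by apply: measurableT_comp => //; exact: measurable_funPT.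
Qed.

Hypothesis indep : mutually_independent X.
Hypothesis sym : forall i (A : set R), measurable A ->
  P (X i @^-1` (-%R @^-1` A)) = P (X i @^-1` A).

Let rectangles : set (set (n.-tuple R)) :=
  [set C | exists2 A : 'I_n -> set R, (forall i, measurable (A i)) &
           C = [set t | forall i, A i (tnth t i)]].

Let flip_rectangle b (A : 'I_n -> set R) : (forall i, measurable (A i)) ->
  P ((fun w => [tuple flip b i w | i < n]) @^-1` [set t | forall i, A i (tnth t i)]) =
  (\prod_(i < n) P (X i @^-1` A i))%E.
Proof.
move=> mA; pose B i := if b i then -%R @^-1` A i else A i.
have mB i : measurable (B i).
  rewrite /B; case: (b i) => //; rewrite -[X in measurable X]setTI.
  exact: oppr_measurable.
rewrite [X in P X](_ : _ = \bigcap_(i in [set: 'I_n]) (X i @^-1` B i)).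
  rewrite indep//; apply: eq_bigr => i _; rewrite /B; case: (b i) => //.
  exact: sym.
apply/seteqP; split => w /= h.
  move=> i _ /=; have := h i; rewrite tnth_mktuple /flip /B.
  by case: (b i).
move=> i; rewrite tnth_mktuple /flip; have := h i I; rewrite /B /=.
by case: (b i).
Qed.

(** Rectangles form a pi-system that generates the measurable sets of tuples,
    and on rectangles both laws are the same product by independence and
    symmetry of each coordinate. *)
Lemma flip_law b (C : set (n.-tuple R)) : measurable C ->
  P ((fun w => [tuple flip b i w | i < n]) @^-1` C) =
  P ((fun w => [tuple X i w | i < n]) @^-1` C).
Proof.
move=> mC.
have m1 := measurable_tuple_of (measurable_flip b).
have m2 : measurable_fun setT (fun w => [tuple X i w | i < n]).
  by apply: measurable_tuple_of => i; exact: measurable_funPT.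
suff : pushforward P (fun w => [tuple flip b i w | i < n]) C =
       pushforward P (fun w => [tuple X i w | i < n]) C by [].
have rect_measurable : rectangles `<=` measurable.
  move=> _ [A mA ->].
  rewrite (_ : [set t | _] = \bigcap_(i in [set: 'I_n]) ((@tnth n R ^~ i) @^-1` A i)).
    apply: fin_bigcap_measurable; first exact: finite_finset.
    move=> i _; rewrite -[X in measurable X]setTI.
    exact: measurable_tnth.
  by apply/seteqP; split => t /= h i //=; exact: h.
have rectI : setI_closed rectangles.
  move=> _ _ [A mA ->] [B mB ->].
  exists (fun i => A i `&` B i); first by move=> i; exact: measurableI.
  apply/seteqP; split => t /=; first by move=> [h1 h2] i; split.
  by move=> h; split => i; have [] := h i.
have rectT : rectangles setT.
  by exists (fun=> setT) => //; apply/seteqP; split.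
apply: (@g_sigma_algebra_measure_unique _ _ _ rectangles rect_measurable
  (fun=> setT) _ _ (pushforward P (fun w => [tuple flip b i w | i < n]))
  (pushforward P (fun w => [tuple X i w | i < n]))) => //.
- by rewrite bigcup_const//; exists 0%N.
- move=> _ [A mA ->]; transitivity (\prod_(i < n) P (X i @^-1` A i))%E.
    exact: (flip_rectangle b mA).
  exact: (esym (flip_rectangle xpred0 mA)).
- by move=> _; rewrite (le_lt_trans (probability_le1 P measurableT))// ltry.
- move: C mC; apply: smallest_sub; first exact: smallest_sigma_algebra.
  rewrite -bigcup_seq/= => _ [i _ [A mA <-]]; apply: sub_sigma_algebra.
  exists (fun j => if j == i then A else setT).
    by move=> j; case: ifP.
  apply/seteqP; split => t /=; last by move=> /(_ i); rewrite eqxx.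
  by move=> [_ At] j; case: eqVneq => // ->.
Qed.

Lemma flip_integral b (F : n.-tuple R -> R) (M : R) :
  measurable_fun setT F -> (forall t, `|F t| <= M) ->
  (\int[P]_w F [tuple flip b i w | i < n])%R =
  (\int[P]_w F [tuple X i w | i < n])%R.
Proof.
move=> mF FM.
have m1 := measurable_tuple_of (measurable_flip b).
have m2 : measurable_fun setT (fun w => [tuple X i w | i < n]).
  by apply: measurable_tuple_of => i; exact: measurable_funPT.
rewrite /Rintegral; congr fine.
rewrite -(@integral_pushforward _ _ _ _ _ _ m1 P setT (EFin \o F))//; last 2 first.
- exact/measurable_EFinP.
- by apply: (@bounded_integrable _ _ _ P _ M) => //; exact: measurableT_comp.
rewrite -(@integral_pushforward _ _ _ _ _ _ m2 P setT (EFin \o F))//; last 2 first.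
- exact/measurable_EFinP.
- by apply: (@bounded_integrable _ _ _ P _ M) => //; exact: measurableT_comp.
by apply: eq_measure_integral => A mA _; exact: flip_law.
Qed.

End sign_flips.

(** * The corner function along a discrete path *)

Section running_extrema.
Context {R : realType}.
Implicit Types (s : nat -> R) (k h m M x y : R).

Fixpoint runmax s j := if j is i.+1 then Num.max (runmax s i) (s j) else s 0%N.
Fixpoint runmin s j := if j is i.+1 then Num.min (runmin s i) (s j) else s 0%N.

Lemma eq_runmax s s' j : (forall i, (i <= j)%N -> s i = s' i) -> runmax s j = runmax s' j.
Proof.
elim: j => [|j IH] ss' /=; first by rewrite ss'.
by rewrite ss' ?IH// => i ij; rewrite ss'// ltnW.
Qed.

Lemma eq_runmin s s' j : (forall i, (i <= j)%N -> s i = s' i) -> runmin s j = runmin s' j.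
Proof.
elim: j => [|j IH] ss' /=; first by rewrite ss'.
by rewrite ss' ?IH// => i ij; rewrite ss'// ltnW.
Qed.

Lemma le_runmax s i j : (i <= j)%N -> s i <= runmax s j.
Proof.
elim: j => [|j IH]; first by rewrite leqn0 => /eqP->.
by rewrite leq_eqVlt le_max => /predU1P[->|/IH->//]; rewrite lexx orbT.
Qed.

Lemma ge_runmin s i j : (i <= j)%N -> runmin s j <= s i.
Proof.
elim: j => [|j IH]; first by rewrite leqn0 => /eqP->.
by rewrite leq_eqVlt ge_min => /predU1P[->|/IH->//]; rewrite lexx orbT.
Qed.

Lemma runmax_le s j c : (forall i, (i <= j)%N -> s i <= c) -> runmax s j <= c.
Proof.
elim: j => [|j IH] sc /=; first exact: sc.
by rewrite ge_max sc// IH// => i ij; rewrite sc// ltnW.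
Qed.

(** The formula is a product in order to be visibly continuous when M - m
    crosses h; see corner_small for the sum of cosines that it stands for. *)
Definition corner k h m M x :=
  2 * cos (k * (x - (m + M) / 2)) * cos (k * Num.min (M - m) h / 2).

Lemma cornerN k h m M x : corner k h (- M) (- m) (- x) = corner k h m M x.
Proof.
rewrite /corner (_ : k * (- x - _) = - (k * (x - (m + M) / 2))); last by field.
by rewrite cosN (_ : - m - - M = M - m)//; ring.
Qed.

Lemma corner_le2 k h m M x : `|corner k h m M x| <= 2.
Proof.
rewrite /corner !normrM ger0_norm// -mulrA ler_piMr//.
by rewrite mulr_ile1 ?cos_max.
Qed.

Lemma corner_small k h m M x : M - m <= h ->
  corner k h m M x = cos (k * (x - m)) + cos (k * (x - M)).
Proof.
move=> mMh; rewrite /corner min_l//.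
set a := k * (x - _); set b := k * (M - m) / 2.
have -> : k * (x - m) = a + b by rewrite /a /b; field.
have -> : k * (x - M) = a - b by rewrite /a /b; field.
by rewrite cosD cosB; ring.
Qed.

Section odd_frequency.
Variables (k h : R).
(* This says that k h / 2 is an odd multiple of pi / 2. *)
Hypotheses (k0 : 0 <= k) (kh : cos (k * h / 2) = 0).

Lemma corner_large m M x : h <= M - m -> corner k h m M x = 0.
Proof. by move=> hMm; rewrite /corner min_r// kh mulr0. Qed.

Let cosDkh a : cos (a + k * h) = - cos a.
Proof.
rewrite cosD (_ : k * h = (k * h / 2) *+ 2); last by rewrite -mulr_natl; field.
rewrite cos_mulr2n sin_mulr2n kh; ring.
Qed.

(** When x = M, the part of the corner function that depends on M is stationary
    there, so moving the maximum up by x - M costs only 1 - cos (k (x - M)).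
    If the range crosses h on the way, cos (k (x - m)) is rewritten as
    - cos (k (x - m - h)), and only the part of the move below h is charged. *)
Let corner_step_up m M x y : m <= y <= M -> M < x ->
  `|corner k h m x x - corner k h m M x| <=
  k * (Num.min (x - m) h - Num.min (M - m) h) * Num.min 1 (k * `|x - y|).
Proof.
move=> /andP[my yM] Mx.
have [hMm|Mmh] := leP h (M - m).
  rewrite !corner_large//; last lra.
  have -> : Num.min (x - m) h = h by rewrite min_r//; lra.
  by rewrite !subrr normr0 mulr0 mul0r.
have step : Num.min 1 (k * (x - M)) <= Num.min 1 (k * `|x - y|).
  rewrite le_min ge_min lexx/= ge_min; apply/orP; right.
  by rewrite ler_wpM2l//; apply: (le_trans _ (ler_norm _)); lra.
rewrite (corner_small k x (ltW Mmh)).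
have kxM : 0 <= k * (x - M) by rewrite mulr_ge0// subr_ge0 ltW.
have [xmh|hxm] := leP (x - m) h.
  rewrite corner_small// subrr mulr0 cos0.
  have := @cos_lipschitz_min R 0 (k * (x - M)); rewrite lexx kxM cos0 => /(_ isT) le.
  rewrite [X in `|X|](_ : _ = - (cos (k * (x - M)) - 1)); last by ring.
  rewrite normrN (le_trans le)// subr0.
  have -> : x - m - (M - m) = x - M by ring.
  by rewrite ler_wpM2l.
rewrite corner_large ?(ltW hxm)// sub0r normrN.
have -> : k * (x - m) = k * (x - m - h) + k * h by ring.
rewrite cosDkh addrC.
have uv : 0 <= k * (x - m - h) <= k * (x - M).
  by rewrite mulr_ge0 ?ler_wpM2l//; lra.
rewrite (le_trans (cos_lipschitz_min uv))//.
have -> : k * (x - M) - k * (x - m - h) = k * (h - (M - m)) by ring.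
by rewrite ler_wpM2l// mulr_ge0// subr_ge0 ltW.
Qed.

Lemma corner_step m M x y : m <= y <= M ->
  `|corner k h (Num.min m x) (Num.max M x) x - corner k h m M x| <=
  k * (Num.min (Num.max M x - Num.min m x) h - Num.min (M - m) h) *
    Num.min 1 (k * `|x - y|).
Proof.
move=> myM; have /andP[my yM] := myM.
have [xM|Mx] := leP x M; last first.
  by rewrite (min_l (le_trans my (le_trans yM (ltW Mx)))); exact: corner_step_up.
have [mx|xm] := leP m x; first by rewrite !subrr normr0 mulr0 mul0r.
have := @corner_step_up (- M) (- m) (- x) (- y).
rewrite !lerN2 ltrN2 yM my xm -(opprK x) !cornerN !opprK => /(_ isT isT).
rewrite (_ : - x + M = M - x); last by ring.
rewrite (_ : - m + M = M - m); last by ring.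
by rewrite (_ : - x + y = - (x - y)) ?normrN//; ring.
Qed.

(** The errors of the single steps are proportional to the increments of
    min (range, h), so their sum telescopes and stays below k h times a factor
    that is small with the steps. *)
Lemma corner_path_variation s (n : nat) (e : R) : 0 <= h -> 0 <= e ->
  (forall j, (j < n)%N -> `|s j.+1 - s j| <= e) ->
  \sum_(j < n) `|corner k h (runmin s j.+1) (runmax s j.+1) (s j.+1) -
                 corner k h (runmin s j) (runmax s j) (s j.+1)| <=
  k * h * Num.min 1 (k * e).
Proof.
move=> h0 e0 se.
pose rho j := Num.min (runmax s j - runmin s j) h.
have min0 : 0 <= Num.min 1 (k * e) by rewrite le_min ler01 mulr_ge0.
apply: (@le_trans _ _ (\sum_(j < n) k * (rho j.+1 - rho j) * Num.min 1 (k * e))).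
  apply: ler_sum => j _.
  have le_ss : runmin s j <= s j <= runmax s j by rewrite ge_runmin ?le_runmax.
  apply: le_trans (corner_step (s j.+1) le_ss) _.
  rewrite ler_wpM2l//.
    rewrite mulr_ge0// subr_ge0 /rho /= le_min !ge_min lexx orbT andbT.
    apply/orP; left.
    by rewrite lerB// ?le_max ?ge_min ?lexx.
  rewrite le_min ge_min lexx/= ge_min; apply/orP; right.
  by rewrite ler_wpM2l// se.
rewrite -mulr_suml -mulr_sumr -(big_mkord xpredT (fun j => rho j.+1 - rho j)).
rewrite telescope_sumr// ler_wpM2r// ler_wpM2l//.
have -> : rho 0%N = 0 by rewrite /rho /= subrr min_l.
by rewrite subr0 /rho ge_min lexx orbT.
Qed.

End odd_frequency.
End running_extrema.

(** * Reflection of a random walk *)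

Section measurable_extrema.
Context d (T : measurableType d) (R : realType).
Variable s : nat -> T -> R.
Hypothesis ms : forall i, measurable_fun setT (s i).

Lemma measurable_runmax j : measurable_fun setT (fun t => runmax (s ^~ t) j).
Proof.
elim: j => [|j IH] /=; first exact: ms.
by apply: measurable_maxr => //; exact: ms.
Qed.

Lemma measurable_runmin j : measurable_fun setT (fun t => runmin (s ^~ t) j).
Proof.
elim: j => [|j IH] /=; first exact: ms.
by apply: measurable_minr => //; exact: ms.
Qed.

Lemma measurable_corner k h (m M x : T -> R) : measurable_fun setT m ->
  measurable_fun setT M -> measurable_fun setT x ->
  measurable_fun setT (fun t => corner k h (m t) (M t) (x t)).
Proof.
have mcos : measurable_fun setT (@cos R).
  by apply: continuous_measurable_fun; exact: continuous_cos.
move=> mm mM mx; apply: measurable_funM.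
  apply: measurable_funM => //; apply: (measurableT_comp mcos).
  apply: measurable_funM => //; apply: measurable_funB => //.
  by apply: measurable_funM => //; exact: measurable_funD.
apply: (measurableT_comp mcos); apply: measurable_funM => //.
apply: measurable_funM => //; apply: measurable_minr => //.
exact: measurable_funB.
Qed.

End measurable_extrema.

(** The points x and 2 y - x are symmetric about y, and a sum of cosines at
    symmetric points is a product. *)
Lemma corner_reflection_identity (R : realType) (k h m M x y : R) :
  corner k h m M (2 * y - x) + corner k h m M x =
  2 * (corner k h m M y * cos (k * (x - y))).
Proof.
rewrite /corner; set c := (m + M) / 2; set C := cos (_ * Num.min _ _ / 2).
have -> : k * (2 * y - x - c) = k * (y - c) - k * (x - y) by ring.
have -> : k * (x - c) = k * (y - c) + k * (x - y) by ring.
by rewrite cosB cosD; ring.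
Qed.

Section reflected_walk.
Context d (Omega : measurableType d) (R : realType) (P : probability Omega R).
Variables (n : nat) (X : 'I_n -> {RV P >-> R}) (S : nat -> Omega -> R).
Hypothesis indep : mutually_independent X.
Hypothesis sym : forall i (A : set R), measurable A ->
  P (X i @^-1` (-%R @^-1` A)) = P (X i @^-1` A).
Hypothesis mS : forall j, measurable_fun setT (S j).
Hypothesis S0 : forall w, S 0%N w = 0.
Hypothesis XS : forall (i : 'I_n) w, X i w = S i.+1 w - S i w.

(** The path is expressed through its increments because the sign flips act on
    tuples of increments. *)
Let walk (t : n.-tuple R) (j : nat) : R := \sum_(i < n | (i < j)%N) tnth t i.

Let measurable_walk j : measurable_fun setT (walk ^~ j).
Proof.
rewrite (_ : walk ^~ j = fun t => \sum_(i < n) (if (i < j)%N then tnth t i else 0)).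
  by apply: measurable_sum => i; case: (i < j)%N => //; exact: measurable_tnth.
by apply/funext => t; rewrite /walk big_mkcond.
Qed.

Let walkE w j : (j <= n)%N -> walk [tuple X i w | i < n] j = S j w.
Proof.
elim: j => [_|j IH jn]; first by rewrite S0 /walk big_pred0.
rewrite /walk (bigD1 (Ordinal jn))//= tnth_mktuple XS /= -(IH (ltnW jn)) addrAC.
rewrite /walk; set a := \sum_(_ < _ | _) _; set b := \sum_(_ < _ | _) _.
suff -> : a = b by ring.
by apply: eq_bigl => i; rewrite ltnS ltn_neqAle andbC.
Qed.

(** Flipping all increments from index i on reflects the rest of the path about
    its position at time i. *)
Let walk_flip w i j : (i <= j)%N -> (j <= n)%N ->
  walk [tuple flip X (fun a => (i <= a)%N) a w | a < n] j = 2 * S i w - S j w.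
Proof.
move=> /subnKC <-; elim: (j - i)%N => [|l IH].
  rewrite addn0 => iN.
  rewrite (_ : 2 * _ - _ = S i w); last by ring.
  rewrite -walkE//; apply: eq_bigr => a ai.
  by rewrite !tnth_mktuple /flip leqNgt ai.
rewrite addnS => jn.
rewrite /walk (bigD1 (Ordinal jn))//= tnth_mktuple /flip leq_addr XS /=.
have := IH (ltnW jn); rewrite /walk.
set a := \sum_(_ < _ | _) _; set b := \sum_(_ < _ | _) _.
suff -> : a = b by move=> ->; ring.
by apply: eq_bigl => a'; rewrite ltnS [in LHS]ltn_neqAle andbC.
Qed.

(** This stands for conditioning on the first j steps: the extrema up to time i
    are unchanged by the reflection after time j >= i, so the end point S n may
    be averaged with its mirror image 2 S j - S n. *)
Lemma corner_reflection_principle k h i j : (i <= j)%N -> (j <= n)%N ->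
  (\int[P]_w corner k h (runmin (S ^~ w) i) (runmax (S ^~ w) i) (S n w))%R =
  (\int[P]_w (corner k h (runmin (S ^~ w) i) (runmax (S ^~ w) i) (S j w) *
              cos (k * (S n w - S j w))))%R.
Proof.
move=> ij jn.
pose F (t : n.-tuple R) := corner k h (runmin (walk t) i) (runmax (walk t) i) (walk t n).
have mF : measurable_fun setT F.
  apply: measurable_corner; [exact: measurable_runmin|exact: measurable_runmax|].
  exact: measurable_walk.
have flipF := flip_integral indep sym (fun a : 'I_n => (j <= a)%N) mF (fun t => corner_le2 _ _ _ _ _).
have FX w : F [tuple X i w | i < n] =
    corner k h (runmin (S ^~ w) i) (runmax (S ^~ w) i) (S n w).
  rewrite /F walkE// (@eq_runmin _ _ (S ^~ w)) 1?(@eq_runmax _ _ (S ^~ w))//.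
    by move=> l li; rewrite walkE// (leq_trans li)// (leq_trans ij).
  by move=> l li; rewrite walkE// (leq_trans li)// (leq_trans ij).
have Fflip w : F [tuple flip X (fun a => (j <= a)%N) i w | i < n] =
    corner k h (runmin (S ^~ w) i) (runmax (S ^~ w) i) (2 * S j w - S n w).
  have walk_le l : (l <= i)%N ->
      walk [tuple flip X (fun a => (j <= a)%N) i w | i < n] l = S l w.
    move=> li; rewrite -walkE ?(leq_trans li)// ?(leq_trans ij)//.
    apply: eq_bigr => a al; rewrite !tnth_mktuple /flip leqNgt.
    by rewrite (leq_trans al) ?(leq_trans li).
  by rewrite /F walk_flip// (@eq_runmin _ _ (S ^~ w)) 1?(@eq_runmax _ _ (S ^~ w)).
have mc x : measurable_fun setT x -> P.-integrable setT
   (EFin \o (fun w => corner k h (runmin (S ^~ w) i) (runmax (S ^~ w) i) (x w))).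
  move=> mx; apply: (@bounded_integrable _ _ _ P _ 2); last by move=> w; exact: corner_le2.
  by apply: measurable_corner => //; [exact: measurable_runmin|exact: measurable_runmax].
have I12 : (\int[P]_w corner k h (runmin (S ^~ w) i) (runmax (S ^~ w) i) (2 * S j w - S n w))%R =
    (\int[P]_w corner k h (runmin (S ^~ w) i) (runmax (S ^~ w) i) (S n w))%R.
  transitivity (\int[P]_w F [tuple flip X (fun a => (j <= a)%N) i w | i < n])%R.
    by apply: eq_Rintegral => w _; rewrite Fflip.
  by rewrite flipF; apply: eq_Rintegral => w _; rewrite FX.
have mSj : measurable_fun setT (fun w => 2 * S j w - S n w).
  by apply: measurable_funB => //; exact: measurable_funM.
apply: (@mulfI _ 2) => //.
rewrite mulr_natl mulr2n -{1}I12 -RintegralD ?mc//.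
rewrite -RintegralZl//; last first.
  apply: (@bounded_integrable _ _ _ P _ 2).
    apply: measurable_funM; last first.
      apply: measurableT_comp; last by apply: measurable_funM => //; exact: measurable_funB.
      by apply: continuous_measurable_fun; exact: continuous_cos.
    by apply: measurable_corner => //; [exact: measurable_runmin|exact: measurable_runmax].
  by move=> w; rewrite normrM -[leRHS]mulr1 ler_pM ?corner_le2 ?cos_max.
apply: eq_Rintegral => w _; rewrite corner_reflection_identity.
by [].
Qed.

(** Both terms of the telescoping sum are brought to time j + 1 by the reflection
    principle; the common factor cos (k (S n - S j.+1)) is at most 1 in absolute
    value and disappears from the bound. *)
Lemma corner_martingale_defect k h :
  `|(\int[P]_w corner k h (runmin (S ^~ w) n) (runmax (S ^~ w) n) (S n w))%R -
    (\int[P]_w corner k h 0 0 (S n w))%R| <=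
  (\int[P]_w \sum_(j < n)
     `|corner k h (runmin (S ^~ w) j.+1) (runmax (S ^~ w) j.+1) (S j.+1 w) -
       corner k h (runmin (S ^~ w) j) (runmax (S ^~ w) j) (S j.+1 w)|)%R.
Proof.
pose D i j w := corner k h (runmin (S ^~ w) i) (runmax (S ^~ w) i) (S j w).
have mD i j : measurable_fun setT (D i j).
  by apply: measurable_corner => //; [exact: measurable_runmin|exact: measurable_runmax].
have mc j : measurable_fun setT (fun w => cos (k * (S n w - S j w))).
  apply: measurableT_comp; last by apply: measurable_funM => //; exact: measurable_funB.
  by apply: continuous_measurable_fun; exact: continuous_cos.
have iDc i j : P.-integrable setT (EFin \o (fun w => D i j w * cos (k * (S n w - S j w)))).
  apply: (@bounded_integrable _ _ _ P _ 2); first exact: measurable_funM.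
  by move=> w; rewrite normrM -[leRHS]mulr1 ler_pM ?corner_le2 ?cos_max.
pose V j w := `|D j.+1 j.+1 w - D j j.+1 w|.
have mV j : measurable_fun setT (V j).
  by apply: measurableT_comp => //; exact: measurable_funB.
have V_le4 j w : `|V j w| <= 4.
  rewrite normr_id (le_trans (ler_normB _ _))// (_ : 4 = 2 + 2); last by ring.
  by rewrite lerD// corner_le2.
have iV j : P.-integrable setT (EFin \o V j).
  exact: (@bounded_integrable _ _ _ P _ 4).
have <- : (\int[P]_w D 0%N n w)%R = (\int[P]_w corner k h 0 0 (S n w))%R.
  by apply: eq_Rintegral => w _; rewrite /D /= S0.
have step j : (j < n)%N -> `|(\int[P]_w D j.+1 n w)%R - (\int[P]_w D j n w)%R| <= (\int[P]_w V j w)%R.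
  move=> jn; rewrite /D (corner_reflection_principle k h (leqnn j.+1) jn) (corner_reflection_principle k h (leqnSn j) jn).
  rewrite -RintegralB ?iDc//; apply: le_trans (le_normr_Rintegral _ _) _ => //.
    rewrite /comp; under eq_fun do rewrite EFinB; apply: integrableB => //; exact: iDc.
  apply: le_Rintegral => //.
    apply: (integrable_norm (f := _)).
    rewrite /comp; under eq_fun do rewrite EFinB; apply: integrableB => //; exact: iDc.
  move=> w _; rewrite -mulrBl normrM ler_piMr//; exact: cos_max.
suff telescope m : (m <= n)%N -> `|(\int[P]_w D m n w)%R - (\int[P]_w D 0%N n w)%R| <=
    (\int[P]_w \sum_(j < m) V j w)%R.
  exact: telescope.
elim: m => [_|m IH mn].
  by rewrite subrr normr0 Rintegral_ge0// => w _; rewrite big_ord0.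
have -> : (\int[P]_w \sum_(j < m.+1) V j w)%R = (\int[P]_w \sum_(j < m) V j w)%R + (\int[P]_w V m w)%R.
  rewrite -RintegralD//; last first.
    apply: (@bounded_integrable _ _ _ P _ (\sum_(j < m) 4)).
      by apply: measurable_sum => j; exact: mV.
    move=> w; rewrite (le_trans (ler_norm_sum _ _ _))//; apply: ler_sum => j _.
    exact: V_le4.
  by apply: eq_Rintegral => w _; rewrite big_ord_recr.
rewrite -(subrK (\int[P]_w D m n w)%R (\int[P]_w D m.+1 n w)%R) -addrA addrC.
by rewrite (le_trans (ler_normD _ _))// lerD ?IH ?step// ltnW.
Qed.

End reflected_walk.

(** * Sampling a continuous path on a grid *)

Section sampling_a_path.
Context {R : realType}.
Variables (T : R) (f : R -> R).
Hypotheses (T0 : 0 < T) (cf : {within `[0, T], continuous f}).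

(** Uniform continuity on a segment, obtained from the covering form of
    compactness. *)
Lemma uniform_modulus (e : R) : 0 < e -> \forall n \near \oo,
  forall s t, 0 <= s <= T -> 0 <= t <= T -> `|s - t| <= T / n.+1%:R ->
  `|f s - f t| <= e.
Proof.
move=> e0.
have cpt : near_covering_within `[0%R, T]%classic.
  by apply/near_covering_withinP/compact_near_coveringP; exact: segment_compact.
pose Q n s := forall t, 0 <= t <= T -> `|s - t| <= T / n.+1%:R -> `|f s - f t| <= e.
have /cpt : forall x, `[0, T]%classic x ->
    \forall s \near x & n \near \oo, `[0, T]%classic s -> Q n s.
  move=> x xT.
  have /cvgrPdist_lt/(_ (e / 2)) : f u @[u --> within `[0, T] (nbhs x)] --> f x.
    by move/subspace_continuousP : cf; exact.
  rewrite divr_gt0// => /(_ isT)[r /= r0 fr].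
  exists ([set u | `|x - u| < r / 2], [set n | T / n.+1%:R < r / 2]) => /=.
    split; first by exists (r / 2) => /=; rewrite ?divr_gt0.
    have := @cvg_div_succ R T => /cvgrPdist_lt/(_ (r / 2)).
    rewrite divr_gt0// => /(_ isT); apply: filterS => n; rewrite sub0r normrN.
    by apply: le_lt_trans; exact: ler_norm.
  move=> [u n] /= [xu Tn] uT t tT ut.
  have r2 : r / 2 < r by rewrite ltr_pdivrMr// ltr_pMr// ltr1n.
  have fu : `|f x - f u| < e / 2 by apply: fr => //=; exact: lt_trans r2.
  have ft : `|f x - f t| < e / 2.
    apply: fr => //=.
    have -> : x - t = (x - u) + (u - t) by ring.
    rewrite (le_lt_trans (ler_normD _ _))// [ltRHS](splitr r).
    by rewrite ltrD// (le_lt_trans ut).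
  have -> : f u - f t = (f x - f t) - (f x - f u) by ring.
  by rewrite (le_trans (ler_normB _ _))// [leRHS](splitr e) lerD// ltW.
apply: filterS => n nQ s t sT tT st.
by apply: nQ => //=; rewrite in_itv.
Qed.

(** There are n + 1 steps, so that the grid is never degenerate. *)
Definition grid n j : R := T * j%:R / n.+1%:R.

Lemma grid_bounds n j : (j <= n.+1)%N -> 0 <= grid n j <= T.
Proof.
move=> jn; rewrite divr_ge0 ?mulr_ge0 ?(ltW T0)//= ler_pdivrMr ?ltr0n//.
by rewrite ler_wpM2l ?(ltW T0)// ler_nat.
Qed.

Lemma grid_step n j : grid n j.+1 - grid n j = T / n.+1%:R.
Proof. by rewrite /grid -mulrBl -mulrBr -addn1 natrD addrC addKr mulr1. Qed.

Lemma grid_end n : grid n n.+1 = T.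
Proof. by rewrite /grid mulfK// gt_eqF// ltr0n. Qed.

Lemma sampled_steps_small (e : R) : 0 < e -> \forall n \near \oo,
  forall j, (j < n.+1)%N -> `|f (grid n j.+1) - f (grid n j)| <= e.
Proof.
move=> /uniform_modulus; apply: filterS => n fn j jn.
apply: fn; rewrite ?grid_bounds//; first exact: ltnW.
by rewrite grid_step ger0_norm// divr_ge0// ltW.
Qed.

Lemma path_has_ubound : has_ubound [set f t | t in `]0, T[].
Proof.
have [c _ fc] := EVT_max (ltW T0) cf.
by exists (f c) => _ [t /= tT <-]; apply: fc; exact: subset_itv_oo_cc.
Qed.

Lemma path_nonempty : [set f t | t in `]0, T[] !=set0.
Proof.
exists (f (T / 2)); exists (T / 2) => //=; rewrite in_itv/= divr_gt0//=.
by rewrite ltr_pdivrMr// ltr_pMr// ltr1n.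
Qed.

(** The supremum is taken over the open interval, but the path is continuous at
    its ends. *)
Lemma path_le_sup t : 0 <= t <= T -> f t <= sup [set f t | t in `]0, T[].
Proof.
move=> tT; apply/ler_addgt0Pr => e e0.
near (\oo) => n.
(* The point t pushed towards the middle, hence into the open interval. *)
pose u := t + (T / 2 - t) / n.+1%:R.
have n1 : 1 <= n.+1%:R :> R by rewrite ler1n.
have uT : 0 < u < T.
  have -> : u = (1 - n.+1%:R^-1) * t + n.+1%:R^-1 * (T / 2) by rewrite /u; ring.
  have v0 : 0 < (n.+1%:R)^-1 :> R by rewrite invr_gt0.
  have v1 : (n.+1%:R)^-1 <= 1 :> R by rewrite invf_le1.
  move: (n.+1%:R^-1) v0 v1 => v v0 v1; case/andP: tT => ? ?.
  have a : 0 <= (1 - v) * t by rewrite mulr_ge0 ?subr_ge0.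
  have b : 0 <= (1 - v) * (T - t) by rewrite mulr_ge0 ?subr_ge0.
  have c : 0 < v * T by rewrite mulr_gt0.
  by apply/andP; split; lra.
have fu : f u <= sup [set f t | t in `]0, T[].
  apply: ub_le_sup; first exact: path_has_ubound.
  by exists u => //=; rewrite in_itv.
suff : `|f u - f t| <= e by rewrite ler_norml => /andP[? ?]; lra.
have uTc : 0 <= u <= T by case/andP: uT => /ltW-> /ltW->.
have : forall s t, 0 <= s <= T -> 0 <= t <= T -> `|s - t| <= T / n.+1%:R ->
  `|f s - f t| <= e by near: n; exact: uniform_modulus.
apply => //; rewrite /u addrC addKr normrM [`|_^-1|]ger0_norm ?invr_ge0//.
rewrite ler_wpM2r ?invr_ge0// ler_norml; case/andP: tT => ? ?.
by apply/andP; split; lra.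
Unshelve. all: by end_near. Qed.

Lemma cvg_sampled_max :
  runmax (fun j => f (grid n j)) n.+1 @[n --> \oo] --> sup [set f t | t in `]0, T[].
Proof.
apply/cvgrPdist_le => e e0.
have := uniform_modulus e0; apply: filterS => n fn.
rewrite ler_norml; apply/andP; split.
  have : runmax (fun j => f (grid n j)) n.+1 <= sup [set f t | t in `]0, T[].
    by apply: runmax_le => i /grid_bounds; exact: path_le_sup.
  by lra.
rewrite lerBlDr; apply: ge_sup; first exact: path_nonempty.
move=> _ [t /= + <-]; rewrite in_itv/= => /andP[t0 tT].
(* The grid point just before t has index floor (t (n + 1) / T). *)
pose x := t * n.+1%:R / T.
have x0 : 0 <= x by rewrite divr_ge0 ?mulr_ge0 // ltW.
have /andP[ix xi] := truncn_itv x0.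
set i := Num.truncn x in ix xi.
have iN : (i <= n.+1)%N.
  rewrite -(ler_nat R) (le_trans ix)// ler_pdivrMr// [leRHS]mulrC ler_wpM2r//.
  exact: ltW.
have tE : t = T * x / n.+1%:R.
  by rewrite /x; field; rewrite (gt_eqF T0) andbT addrC natr1 pnatr_eq0.
have : `|f t - f (grid n i)| <= e.
  apply: fn; rewrite ?grid_bounds// ?(ltW t0) ?(ltW tT)//.
  rewrite tE /grid -mulrBl -mulrBr normrM [`|_^-1|]ger0_norm ?invr_ge0//.
  rewrite ler_wpM2r ?invr_ge0// normrM gtr0_norm// ler_piMr ?(ltW T0)//.
  by rewrite ler_norml; move: xi; rewrite -natr1 => ?; apply/andP; split; lra.
have := @le_runmax R (fun j => f (grid n j)) i n.+1 iN.
by rewrite /= ler_norml => ? /andP[? ?]; lra.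
Qed.

End sampling_a_path.

Lemma runminN {R : realType} (s : nat -> R) j : runmin s j = - runmax (fun i => - s i) j.
Proof. by elim: j => [|j IH] /=; rewrite ?opprK// oppr_max opprK IH. Qed.

Lemma cvg_sampled_min (R : realType) (T : R) (f : R -> R) : 0 < T ->
  {within `[0, T], continuous f} ->
  runmin (fun j => f (grid T n j)) n.+1 @[n --> \oo] --> inf [set f t | t in `]0, T[].
Proof.
move=> T0 cf.
under eq_fun do rewrite runminN.
rewrite /inf image_comp; apply: cvgN.
apply: (@cvg_sampled_max R T (fun t => - f t)) => //.
by move=> x; apply: continuousN; exact: cf.
Qed.

(** * The corner function of the Wiener process *)

Lemma cvg_corner (R : realType) (k h m M x : R) (m_ M_ x_ : nat -> R) :
  m_ n @[n --> \oo] --> m -> M_ n @[n --> \oo] --> M -> x_ n @[n --> \oo] --> x ->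
  corner k h (m_ n) (M_ n) (x_ n) @[n --> \oo] --> corner k h m M x.
Proof.
move=> cm cM cx.
have ccos (u : nat -> R) (a : R) : u n @[n --> \oo] --> a -> cos (u n) @[n --> \oo] --> cos a.
  by move=> ua; apply: continuous_cvg => //; exact: continuous_cos.
have cmulr (u : nat -> R) (a c : R) : u n @[n --> \oo] --> a -> c * u n @[n --> \oo] --> c * a.
  by move=> ua; apply: cvgM => //; exact: cvg_cst.
apply: cvgM.
  apply: (cmulr); apply: (ccos); apply: (cmulr); apply: cvgB => //.
  by apply: cvgM; [exact: cvgD|exact: cvg_cst].
apply: (ccos); apply: cvgM; last exact: cvg_cst.
apply: (cmulr); under eq_fun do rewrite minr_absE; rewrite minr_absE.
have cMm : M_ n - m_ n @[n --> \oo] --> M - m by exact: cvgB.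
have ch : h @[_ --> \oo] --> h by exact: cvg_cst.
apply: cvgM; last exact: cvg_cst.
by apply: cvgB; [exact: cvgD|apply: cvg_norm; exact: cvgB].
Qed.

Section wiener_corner.
Context (R : realType) d (Omega : measurableType d) (P : probability Omega R).
Variables (W : R -> {RV P >-> R}) (T : R).
Hypotheses (T0 : 0 < T) (hW : standard_wiener_process W).

Definition path_sup w := sup [set W t w | t in `]0, T[].
Definition path_inf w := inf [set W t w | t in `]0, T[].

Let path_continuous w : {within `[0, T], continuous (fun t : R => W t w)}.
Proof.
apply: continuous_subspaceW (wiener_continuous hW (w := w)).
by move=> t /=; rewrite !in_itv/= => /andP[->].
Qed.

Lemma path_inf_le_sup w : path_inf w <= W T w <= path_sup w.
Proof.
have T1 : 0 <= T <= T by rewrite lexx ltW.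
rewrite (path_le_sup T0 (@path_continuous w))// andbT /path_inf /inf image_comp lerNl.
apply: (@path_le_sup R T (fun t => - W t w) T0 _ T T1).
by move=> x; apply: continuousN; exact: path_continuous.
Qed.

Let sampled n (j : nat) : Omega -> R := W (grid T n j).

Let measurable_sampled n j : measurable_fun setT (sampled n j).
Proof. exact: measurable_funPT. Qed.

Lemma measurable_path_sup : measurable_fun setT path_sup.
Proof.
apply: (measurable_fun_cvg (h := fun n w => runmax (sampled n ^~ w) n.+1)) => //.
  by move=> n; exact: measurable_runmax.
by move=> w _; exact: (@cvg_sampled_max R T (W ^~ w)).
Qed.

Lemma measurable_path_inf : measurable_fun setT path_inf.
Proof.
apply: (measurable_fun_cvg (h := fun n w => runmin (sampled n ^~ w) n.+1)) => //.
  by move=> n; exact: measurable_runmin.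
by move=> w _; exact: (@cvg_sampled_min R T (W ^~ w)).
Qed.

Lemma wiener_cos k : (\int[P]_w cos (k * W T w))%R = expR (- (k ^+ 2 * T / 2)).
Proof.
have sT : 0 < Num.sqrt T by rewrite sqrtr_gt0.
have := @expectation_cos_normal _ _ _ P (increment W 0 T) (Num.sqrt T) k sT.
rewrite sqr_sqrtr ?(ltW T0)// => <-.
  apply: eq_Rintegral => w _; rewrite /increment /=.
  by rewrite (wiener_start hW) subr0.
by move=> A mA; rewrite (wiener_normal hW (lexx 0) T0 mA) subr0.
Qed.

Let increment_sym n (i : 'I_n.+1) (A : set R) : measurable A ->
  P (increment W (grid T n i) (grid T n i.+1) @^-1` (-%R @^-1` A)) =
  P (increment W (grid T n i) (grid T n i.+1) @^-1` A).
Proof.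
move=> mA.
have step : 0 < grid T n i.+1 - grid T n i.
  by rewrite grid_step divr_gt0// ltr0n.
have g0 : 0 <= grid T n i.
  by have /andP[] := grid_bounds T0 (ltnW (ltn_ord i)).
have law := wiener_normal hW g0 (_ : grid T n i < grid T n i.+1).
have lt_g : grid T n i < grid T n i.+1 by rewrite -subr_gt0.
have mNA : measurable (-%R @^-1` A : set R).
  by rewrite -[X in measurable X]setTI; exact: oppr_measurable.
have := law lt_g _ mNA; have := law lt_g _ mA; rewrite /distribution /pushforward => -> ->.
by apply: normal_probN => //; rewrite gt_eqF// sqrtr_gt0.
Qed.

(** The sampled Wiener process is a walk with independent symmetric steps. *)
Lemma corner_sampled_error k h n :
  `|(\int[P]_w corner k h (runmin (sampled n ^~ w) n.+1) (runmax (sampled n ^~ w) n.+1) (W T w))%R -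
    (\int[P]_w corner k h 0 0 (W T w))%R| <=
  (\int[P]_w \sum_(j < n.+1)
     `|corner k h (runmin (sampled n ^~ w) j.+1) (runmax (sampled n ^~ w) j.+1) (sampled n j.+1 w) -
       corner k h (runmin (sampled n ^~ w) j) (runmax (sampled n ^~ w) j) (sampled n j.+1 w)|)%R.
Proof.
have -> : W T = W (grid T n n.+1) by rewrite grid_end.
apply: (@corner_martingale_defect _ _ _ P n.+1
  (fun i : 'I_n.+1 => increment W (grid T n i) (grid T n i.+1)) (sampled n)).
- apply: (wiener_independent hW (n := n.+1) (t := grid T n)).
    by rewrite /grid mulr0 mul0r.
  move=> i j ij; rewrite ler_wpM2r ?invr_ge0// ler_wpM2l ?(ltW T0)// ler_nat//.
- by move=> i A mA; exact: increment_sym.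
- exact: measurable_sampled.
- by move=> w; rewrite /sampled /grid mulr0 mul0r (wiener_start hW).
- by [].
Qed.

(** Along finer and finer grids the sampled extrema converge to those of the
    path, and the total error of corner_sampled_error tends to 0 pointwise while
    it stays below k h; dominated convergence gives both limits. *)
Lemma corner_expectation (k h : R) : 0 <= k -> 0 <= h -> cos (k * h / 2) = 0 ->
  (\int[P]_w corner k h (path_inf w) (path_sup w) (W T w))%R =
  2 * expR (- (k ^+ 2 * T / 2)).
Proof.
move=> k0 h0 kh.
have mWT : measurable_fun setT (W T) by exact: measurable_funPT.
have icst (c : R) : P.-integrable setT (EFin \o (fun=> c)).
  by apply: (@bounded_integrable _ _ _ P _ `|c|).
have corner0 : (\int[P]_w corner k h 0 0 (W T w))%R = 2 * expR (- (k ^+ 2 * T / 2)).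
  rewrite -wiener_cos -RintegralZl//; last first.
    apply: (@bounded_integrable _ _ _ P _ 1) => [|w]; last exact: cos_max.
    apply: measurableT_comp; last exact: measurable_funM.
    by apply: continuous_measurable_fun; exact: continuous_cos.
  apply: eq_Rintegral => w _; rewrite corner_small ?subrr// subr0.
  by ring.
rewrite -corner0.
set Q := fun n w => corner k h (runmin (sampled n ^~ w) n.+1) (runmax (sampled n ^~ w) n.+1) (W T w).
have cvgQ : (\int[P]_w Q n w)%R @[n --> \oo] -->
    (\int[P]_w corner k h (path_inf w) (path_sup w) (W T w))%R.
  apply: (@Rintegral_dominated_cvg _ _ _ P _ _ (fun=> 2)) => //.
  - by move=> n; apply: measurable_corner => //; [exact: measurable_runmin|exact: measurable_runmax].
  - move=> w.
    have cm : runmin (sampled n ^~ w) n.+1 @[n --> \oo] --> path_inf w.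
      exact: (@cvg_sampled_min R T (W ^~ w)).
    have cM : runmax (sampled n ^~ w) n.+1 @[n --> \oo] --> path_sup w.
      exact: (@cvg_sampled_max R T (W ^~ w)).
    exact: (cvg_corner cm cM (cvg_cst _)).
  - by move=> n w; exact: corner_le2.
set V := fun n w => \sum_(j < n.+1)
     `|corner k h (runmin (sampled n ^~ w) j.+1) (runmax (sampled n ^~ w) j.+1) (sampled n j.+1 w) -
       corner k h (runmin (sampled n ^~ w) j) (runmax (sampled n ^~ w) j) (sampled n j.+1 w)|.
have cvgV : (\int[P]_w V n w)%R @[n --> \oo] --> (0 : R).
  have -> : 0 = (\int[P]_w (0 : R))%R by rewrite Rintegral_cst// mul0r.
  apply: (@Rintegral_dominated_cvg _ _ _ P _ _ (fun=> k * h)) => //.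
  - move=> n; apply: measurable_sum => j; apply: measurableT_comp => //.
    by apply: measurable_funB; apply: measurable_corner => //;
      try exact: measurable_runmin; exact: measurable_runmax.
  - move=> w; apply/cvgrPdist_le => e e0.
    (* Adding 1 avoids a separate treatment of k h k = 0. *)
    have c0 : 0 < k * h * k + 1 by rewrite ltr_wpDl// !mulr_ge0.
    have e1 : 0 < e / (k * h * k + 1) by rewrite divr_gt0.
    have := sampled_steps_small T0 (@path_continuous w) e1; apply: filterS => n small.
    rewrite sub0r normrN ger0_norm ?sumr_ge0//.
    apply: le_trans (corner_path_variation k0 kh h0 (ltW e1) small) _.
    apply: (@le_trans _ _ (k * h * (k * (e / (k * h * k + 1))))).
      by rewrite ler_wpM2l ?mulr_ge0// ge_min lexx orbT.
    rewrite !mulrA ler_pdivrMr// -subr_ge0.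
    by rewrite (_ : _ - _ = e); [exact: ltW|ring].
  - move=> n w; rewrite ger0_norm ?sumr_ge0//.
    (* Any bound on the steps will do here, as the last factor is at most 1. *)
    pose c := \sum_(j < n.+1) `|sampled n j.+1 w - sampled n j w|.
    have c0 : 0 <= c by rewrite sumr_ge0.
    have jc j : (j < n.+1)%N -> `|sampled n j.+1 w - sampled n j w| <= c.
      move=> jn; rewrite /c (bigD1 (Ordinal jn))//= lerDl sumr_ge0//.
    apply: le_trans (corner_path_variation k0 kh h0 c0 jc) _.
    by rewrite ler_piMr ?mulr_ge0// ge_min lexx.
apply: (cvg_unique (@norm_hausdorff _ _) cvgQ).
apply/cvgrPdist_le => e e0; move/cvgrPdist_le : cvgV => /(_ e e0).
apply: filterS => n; rewrite sub0r normrN => Ve.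
rewrite distrC (le_trans (corner_sampled_error k h n))// (le_trans _ Ve)//.
exact: ler_norm.
Qed.

End wiener_corner.

(** * Series for the corner functions of all odd frequencies *)

Section expected_gap.
Context {R : realType}.
Implicit Types (k n : nat) (h m M x y T : R).

Definition odd_frequency h k : R := k.*2.+1%:R * pi / h.

(** The terms of the series for the expectation of (h - range)^+. *)
Definition gap_term T h k : R :=
  8 * h / (k.*2.+1%:R ^+ 2 * pi ^+ 2) *
  expR (- (k.*2.+1%:R ^+ 2 * pi ^+ 2 * T / (2 * h ^+ 2))).

Let pi_gt0' : 0 < pi :> R. Proof. exact: pi_gt0. Qed.
Let odd_gt0 k : 0 < k.*2.+1%:R :> R. Proof. by rewrite ltr0n. Qed.

Lemma cos_odd_frequency h k : 0 < h -> cos (odd_frequency h k * h / 2) = 0.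
Proof.
move=> h0; rewrite /odd_frequency divfK ?gt_eqF//.
have -> : k.*2.+1%:R * pi / 2 = pi / 2 + pi *+ k :> R.
  by rewrite -addn1 natrD -muln2 natrM -[pi *+ k]mulr_natl; field.
by rewrite (alternatingn (@cosDpi R)) cos_pihalf mulr0.
Qed.

(** For M - m <= h the two cosines of the corner function are values of the
    triangular wave at u = pi (x - m) / h and v = pi (M - x) / h, and
    (pi / 2 - u) + (pi / 2 - v) is proportional to h - (M - m); otherwise all
    terms vanish. *)
Lemma cvg_corner_series h m M x : 0 < h -> m <= x <= M ->
  \sum_(k < n) 4 * h / (k.*2.+1%:R ^+ 2 * pi ^+ 2) *
    corner (odd_frequency h k) h m M x @[n --> \oo] --> Num.max (h - (M - m)) 0.
Proof.
move=> h0 /andP[mx xM].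
have [hMm|Mmh] := leP h (M - m).
  rewrite max_r ?subr_le0//.
  under eq_fun do under eq_bigr do rewrite corner_large ?cos_odd_frequency// mulr0.
  by under eq_fun do rewrite big1//; exact: cvg_cst.
rewrite max_l ?subr_ge0 ?(ltW Mmh)//.
pose u := pi * (x - m) / h; pose v := pi * (M - x) / h.
have le_pi y : 0 <= y -> y <= M - m -> 0 <= pi * y / h <= pi.
  move=> y0 yMm; rewrite divr_ge0 ?mulr_ge0 ?(ltW pi_gt0') ?(ltW h0)//=.
  by rewrite ler_pdivrMr// ler_wpM2l ?(ltW pi_gt0')// (le_trans yMm)// ltW.
have cu : odd_cos_sum n u @[n --> \oo] --> pi / 4 * (pi / 2 - u).
  by apply: cvg_odd_cos_sum; rewrite le_pi //; lra.
have cv : odd_cos_sum n v @[n --> \oo] --> pi / 4 * (pi / 2 - v).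
  by apply: cvg_odd_cos_sum; rewrite le_pi //; lra.
have -> : h - (M - m) = 4 * h / pi ^+ 2 *
    (pi / 4 * (pi / 2 - u) + pi / 4 * (pi / 2 - v)).
  rewrite /u /v; move: (pi) (pi_gt0 R) => p p0; by field; rewrite !gt_eqF.
have -> : (fun n => \sum_(k < n) 4 * h / (k.*2.+1%:R ^+ 2 * pi ^+ 2) *
    corner (odd_frequency h k) h m M x) =
    (fun n => 4 * h / pi ^+ 2 * (odd_cos_sum n u + odd_cos_sum n v)).
  apply/funext => n; rewrite -big_split mulr_sumr; apply: eq_bigr => k _ /=.
  rewrite corner_small ?(ltW Mmh)//.
  have -> : odd_frequency h k * (x - m) = k.*2.+1%:R * u.
    by rewrite /odd_frequency /u; ring.
  have -> : odd_frequency h k * (x - M) = - (k.*2.+1%:R * v).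
    by rewrite /odd_frequency /v; ring.
  rewrite cosN; move: (odd_gt0 k) (pi) (pi_gt0 R); move: (k.*2.+1%:R) => c c0 p p0.
  by field; rewrite !gt_eqF.
by apply: cvgM; [exact: cvg_cst|exact: cvgD].
Qed.

Lemma sum_odd_inv_sqr_le2 n : \sum_(k < n) (k.*2.+1%:R ^+ 2)^-1 <= 2 :> R.
Proof.
have := @quadratic_tail R (fun k => (k.*2.+1%:R ^+ 2)^-1) 1 0 n (leq0n n).
rewrite big_ord0 subr0 divr1 mulr1 => /(_ _)/(le_trans (ler_norm _)); apply.
by move=> k; rewrite div1r ger0_norm// invr_ge0 sqr_ge0.
Qed.

Lemma is_derive_gap_term T h k : 0 < h ->
  is_derive h 1 (gap_term T ^~ k) (ddwpr_term T h k.+1).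
Proof.
move=> h0.
have hV : is_derive h 1 (fun y => (y ^+ 2)^-1 : R) (- (h ^+ 2) ^- 2 * (2 * h)).
  apply: is_deriveV; first by rewrite expf_neq0// gt_eqF.
  have -> : (fun y : R => y ^+ 2) = (id : R -> R) ^+ 2.
    by apply/funext => y; rewrite fctE.
  by apply: is_derive_eq; rewrite /GRing.scale/=; ring.
pose a : R := 8 / (k.*2.+1%:R ^+ 2 * pi ^+ 2).
pose c : R := k.*2.+1%:R ^+ 2 * pi ^+ 2 * T / 2.
have -> : gap_term T ^~ k = (a \*: (id : R -> R)) * (expR \o ((- c) \*: (fun y => (y ^+ 2)^-1))).
  apply/funext => y; rewrite !fctE /gap_term /a /c /GRing.scale/=; congr (_ * expR _).
    by rewrite /GRing.scale/=; ring.
  by rewrite /GRing.scale/= invfM; ring.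
apply: is_derive_eq; rewrite !fctE /GRing.scale/=.
rewrite /ddwpr_term (_ : 2 * k.+1%:R - 1 = k.*2.+1%:R); last first.
  by rewrite -[k.+1]addn1 -[k.*2.+1]addn1 !natrD -muln2 natrM; ring.
set E := expR _; rewrite (_ : expR _ = E); last first.
  by rewrite /E /c; congr expR; rewrite /GRing.scale/=; field; rewrite gt_eqF.
rewrite /a /c /GRing.scale/=; move: (odd_gt0 k) (pi) (pi_gt0 R); move: (k.*2.+1%:R) => o o0 p p0.
by field; rewrite !gt_eqF.
Qed.

(** With - y the exponent, the term is 8 / (pi^2 o^2) (1 + 2 y) exp (- y), and
    (1 + 2 y) exp (- y) <= 2.  The bound does not depend on h, which is what
    allows differentiation under the sum. *)
Lemma ddwpr_term_bounds T h k : 0 < T -> 0 < h ->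
  0 <= ddwpr_term T h k.+1 <= 16 / pi ^+ 2 / k.*2.+1%:R ^+ 2.
Proof.
move=> T0 h0.
rewrite /ddwpr_term (_ : 2 * k.+1%:R - 1 = k.*2.+1%:R); last first.
  by rewrite -[k.+1]addn1 -[k.*2.+1]addn1 !natrD -muln2 natrM; ring.
move: (odd_gt0 k) (pi) (pi_gt0 R); move: (k.*2.+1%:R) => o o0 p p0.
set y := o ^+ 2 * p ^+ 2 * T / (2 * h ^+ 2).
have y0 : 0 < y by rewrite !divr_gt0 ?mulr_gt0 ?exprn_gt0.
have -> : 8 / (o ^+ 2 * p ^+ 2) + 8 * T / h ^+ 2 = 8 / p ^+ 2 / o ^+ 2 * (1 + 2 * y).
  by rewrite /y; field; rewrite !gt_eqF.
have A0 : 0 <= 8 / p ^+ 2 / o ^+ 2 :> R by rewrite !divr_ge0 ?exprn_ge0// ltW.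
apply/andP; split.
  by rewrite mulr_ge0 ?expR_ge0// mulr_ge0// addr_ge0// mulr_ge0// ltW.
have -> : 16 / p ^+ 2 / o ^+ 2 = 8 / p ^+ 2 / o ^+ 2 * 2 by ring.
rewrite -mulrA ler_wpM2l// expRN ler_pdivrMr ?expR_gt0//.
have := expR_ge1Dx y; lra.
Qed.

End expected_gap.

(** * Distribution of the range *)

Section range_distribution.
Context (R : realType) d (Omega : measurableType d) (P : probability Omega R).
Variables (W : R -> {RV P >-> R}) (T : R).
Hypotheses (T0 : 0 < T) (hW : standard_wiener_process W).

Local Notation rangeW := (wiener_range W T).

Lemma measurable_wiener_range : measurable_fun setT rangeW.
Proof. by apply: measurable_funB; [exact: measurable_path_sup|exact: measurable_path_inf]. Qed.

Lemma measurable_range_lt h : measurable [set w | rangeW w < h].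
Proof.
rewrite (_ : [set w | _] = setT `&` rangeW @^-1` `]-oo, h[).
  by apply: measurable_wiener_range => //; exact: measurable_itv.
by rewrite setTI; apply/seteqP; split => w /=; rewrite in_itv.
Qed.

Lemma wiener_range_ge0 w : 0 <= rangeW w.
Proof.
by have /andP[a b] := path_inf_le_sup T0 hW w; rewrite subr_ge0 (le_trans a b).
Qed.

(** Its expectation is the integral of the distribution function up to h, and it
    is what the corner functions compute. *)
Definition gap (h : R) (w : Omega) : R := Num.max (h - rangeW w) 0.

Lemma measurable_gap h : measurable_fun setT (gap h).
Proof.
apply: measurable_maxr => //; apply: measurable_funB => //.
exact: measurable_wiener_range.
Qed.

Lemma gap_bounds h w : 0 <= h -> 0 <= gap h w <= h.
Proof.
move=> h0; rewrite /gap le_max lexx orbT/= ge_max h0 andbT.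
by rewrite gerBl wiener_range_ge0.
Qed.

Lemma integrable_gap h : 0 <= h -> P.-integrable setT (EFin \o gap h).
Proof.
move=> h0; apply: (@bounded_integrable _ _ _ P _ h); first exact: measurable_gap.
by move=> w; have /andP[g0 gh] := gap_bounds w h0; rewrite ger0_norm.
Qed.

(** The corner series is integrated term by term; its partial sums are dominated
    by a multiple of the sum of 1 / o^2. *)
Lemma cvg_expected_gap h : 0 < h ->
  \sum_(k < n) gap_term T h k @[n --> \oo] --> (\int[P]_w gap h w)%R.
Proof.
move=> h0.
pose a k : R := 4 * h / (k.*2.+1%:R ^+ 2 * pi ^+ 2).
have a0 k : 0 <= a k by rewrite divr_ge0 ?mulr_ge0 ?exprn_ge0 ?ltW// pi_gt0.
pose C k w := corner (odd_frequency h k) h (path_inf W T w) (path_sup W T w) (W T w).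
have mC k : measurable_fun setT (C k).
  apply: measurable_corner.
  - exact: measurable_path_inf.
  - exact: measurable_path_sup.
  - exact: measurable_funPT.
have EC k : (\int[P]_w C k w)%R = 2 * expR (- (odd_frequency h k ^+ 2 * T / 2)).
  apply: corner_expectation => //; last exact: cos_odd_frequency.
  - by rewrite divr_ge0 ?mulr_ge0 ?pi_ge0// ltW.
  - exact: ltW.
have -> : (fun n => \sum_(k < n) gap_term T h k) =
    (fun n => (\int[P]_w \sum_(k < n) a k * C k w)%R).
  apply/funext => n.
  have bnd m w : `|\sum_(k < m) a k * C k w| <= \sum_(k < m) a k * 2.
    rewrite (le_trans (ler_norm_sum _ _ _))// ler_sum// => k _.
    by rewrite normrM (ger0_norm (a0 _)) ler_wpM2l// corner_le2.
  have ms m : measurable_fun setT (fun w => \sum_(k < m) a k * C k w).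
    by apply: measurable_sum => k; exact: measurable_funM.
  elim: n => [|n IH].
    by rewrite big_ord0; under eq_Rintegral do rewrite big_ord0; rewrite Rintegral_cst// mul0r.
  under eq_Rintegral do rewrite big_ord_recr/=.
  have iC : P.-integrable setT (EFin \o C n).
    by apply: (@bounded_integrable _ _ _ P _ 2) => // w; exact: corner_le2.
  rewrite big_ord_recr/= IH RintegralD//.
  - rewrite RintegralZl// EC; congr (_ + _).
    rewrite /gap_term /a /odd_frequency.
    have -> : (n.*2.+1%:R * pi / h) ^+ 2 * T / 2 =
        n.*2.+1%:R ^+ 2 * pi ^+ 2 * T / (2 * h ^+ 2).
      by move: (pi) => p; field; rewrite gt_eqF.
    by ring.
  - by apply: (@bounded_integrable _ _ _ P _ _ (ms n)) => w; exact: bnd.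
  - apply: (@bounded_integrable _ _ _ P _ (a n * 2)) => [|w]; first exact: measurable_funM.
    by rewrite normrM (ger0_norm (a0 _)) ler_wpM2l// corner_le2.
apply: (@Rintegral_dominated_cvg _ _ _ P _ _ (fun=> 4 * h / pi ^+ 2 * 4)).
- by move=> n; apply: measurable_sum => k; exact: measurable_funM.
- by move=> w; exact: cvg_corner_series (path_inf_le_sup T0 hW w).
- by apply: (@bounded_integrable _ _ _ P _ `|4 * h / pi ^+ 2 * 4|).
- move=> n w; rewrite (le_trans (ler_norm_sum _ _ _))//.
  apply: (@le_trans _ _ (4 * h / pi ^+ 2 * 2 * (\sum_(k < n) (k.*2.+1%:R ^+ 2)^-1))).
    rewrite mulr_sumr ler_sum// => k _.
    rewrite normrM (ger0_norm (a0 _)).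
    have -> : 4 * h / pi ^+ 2 * 2 * (k.*2.+1%:R ^+ 2)^-1 = a k * 2.
      rewrite /a; move: (pi) (pi_gt0 R) => p p0; field.
      by rewrite (gt_eqF p0) nat1r pnatr_eq0.
    by rewrite ler_wpM2l// corner_le2.
  have -> : 4 * h / pi ^+ 2 * 4 = 4 * h / pi ^+ 2 * 2 * 2 by ring.
  by rewrite ler_wpM2l ?sum_odd_inv_sqr_le2// mulr_ge0// divr_ge0 ?exprn_ge0 ?mulr_ge0 ?pi_ge0// ltW.
Qed.

(** The quotient is taken from the left: its limit is 0 also where the range is
    equal to h, which gives the strict inequality. *)
Lemma gap_quotient_cvg h (w : Omega) (eta : nat -> R) :
  (forall n, 0 < eta n) -> eta n @[n --> \oo] --> (0 : R) ->
  (gap h w - gap (h - eta n) w) / eta n @[n --> \oo] --> (\1_[set w | rangeW w < h] w : R).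
Proof.
move=> eta0 eta_cvg; rewrite indicE; have [rh|hr] := ltP (rangeW w) h.
  rewrite mem_set//=; apply: cvg_near_cst.
  have : 0 < h - rangeW w by rewrite subr_gt0.
  move=> rh0; move/cvgrPdist_lt : eta_cvg => /(_ _ rh0); apply: filterS => n.
  rewrite sub0r normrN gtr0_norm// => en.
  rewrite /gap !max_l; last 2 first.
  - by lra.
  - by lra.
  rewrite (_ : h - rangeW w - (h - eta n - rangeW w) = eta n); last by ring.
  by rewrite divff// gt_eqF.
rewrite memNset//=; last by apply/negP; rewrite -leNgt.
apply: cvg_near_cst; apply: nearW => n; rewrite /gap !max_r ?subrr ?mul0r//.
  by have := eta0 n; lra.
by lra.
Qed.

Lemma gap_quotient_bounds h w e : 0 < e -> 0 <= (gap h w - gap (h - e) w) / e <= 1.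
Proof.
move=> e0; rewrite ler_pdivlMr// ler_pdivrMr// mul0r mul1r /gap.
set r := wiener_range W T w.
by have [?|?] := leP (h - r) 0; have [?|?] := leP (h - e - r) 0;
  apply/andP; split; lra.
Qed.

(** Differentiation of E (h - range)^+ in two ways, along the left increments eta:
    under the expectation by dominated convergence, and under the sum by the
    uniform bound on the derivatives of the terms. *)
Lemma cvg_range_cdf h : 0 < h ->
  \sum_(k < K) ddwpr_term T h k.+1 @[K --> \oo] -->
  fine (P [set w | rangeW w < h]).
Proof.
move=> h0.
have mA := measurable_range_lt h.
pose eta n : R := h / 2 / n.+1%:R.
have eta0 n : 0 < eta n by rewrite !divr_gt0.
have etah n : eta n <= h / 2.
  by rewrite ler_pdivrMr// ler_peMr ?divr_ge0 ?ler1n// ltW.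
have eta_cvg : eta n @[n --> \oo] --> (0 : R) by exact: cvg_div_succ.
pose a n k := (gap_term T h k - gap_term T (h - eta n) k) / eta n.
pose D n := (\int[P]_w ((gap h w - gap (h - eta n) w) / eta n))%R.
have hn n : 0 < h - eta n by have := etah n; lra.
have aD n : \sum_(k < K) a n k @[K --> \oo] --> D n.
  have -> : (fun K => \sum_(k < K) a n k) =
      (fun K => (\sum_(k < K) gap_term T h k - \sum_(k < K) gap_term T (h - eta n) k) / eta n).
    by apply/funext => K; rewrite -mulr_suml sumrB.
  rewrite /D RintegralZr//; last first.
    rewrite /comp; under eq_fun do rewrite EFinB.
    by apply: integrableB => //; apply: integrable_gap; rewrite ltW.
  rewrite RintegralB// ?integrable_gap ?ltW//.
  apply: cvgM; last exact: cvg_cst.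
  by apply: cvgB; exact: cvg_expected_gap.
have a_le n k : `|a n k| <= 16 / pi ^+ 2 / k.*2.+1%:R ^+ 2.
  rewrite /a normrM [`|_^-1|]ger0_norm ?invr_ge0 ?(ltW (eta0 n))//.
  rewrite ler_pdivrMr//.
  pose B : R := 16 / pi ^+ 2 / k.*2.+1%:R ^+ 2.
  have -> : B * eta n = B * h - B * (h - eta n) by ring.
  apply: (@le_variation R (gap_term T ^~ k) (fun y => B * y)
    (fun y => ddwpr_term T y k.+1) (fun=> B) (h - eta n) h).
  - by have := eta0 n; lra.
  - by move=> y /andP[yh _]; apply: is_derive_gap_term; exact: lt_le_trans yh.
  - move=> y _; have -> : (fun y => B * y) = B \*: (id : R -> R) by [].
    by apply: is_derive_eq; rewrite /GRing.scale/= mulr1.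
  - move=> y /andP[yh _].
    have /andP[d0 dB] := ddwpr_term_bounds k T0 (lt_le_trans (hn n) yh).
    by rewrite ger0_norm.
apply: (@cvg_exchange_partial_sums R a (fun k => ddwpr_term T h k.+1) D
  (fun K => 2 * (16 / pi ^+ 2) / K.+1%:R)).
- by move=> n K; exact: (cvg_quadratic_tail _ (a_le n) (aD n)).
- exact: cvg_div_succ.
- have -> : fine (P [set w | rangeW w < h]) = (\int[P]_w \1_[set w | rangeW w < h] w)%R.
    by rewrite /Rintegral integral_indic// setIT.
  apply: (@Rintegral_dominated_cvg _ _ _ P _ _ (fun=> 1)).
  + move=> n; apply: measurable_funM => //.
    by apply: measurable_funB; exact: measurable_gap.
  + by move=> w; exact: gap_quotient_cvg.
  + by apply: (@bounded_integrable _ _ _ P _ 1) => // w; rewrite normr1.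
  + move=> n w; have /andP[q0 q1] := gap_quotient_bounds h w (eta0 n).
    by rewrite ger0_norm.
- move=> k; have [dh <-] := is_derive_gap_term T k h0.
  have Neta : (forall n, - eta n != 0) /\ (- eta n @[n --> \oo] --> (0 : R)).
    split=> [n|]; first by rewrite oppr_eq0 gt_eqF.
    by rewrite -oppr0; exact: cvgN.
  move/cvgr_dnbhsP : dh => /(_ _ Neta); apply: cvg_trans.
  apply: near_eq_cvg; apply: nearW => n /=.
  rewrite /a /GRing.scale/= mulr1 [- eta n + h]addrC; field.
  by rewrite gt_eqF.
Qed.

Lemma range_cdf h : 0 < h ->
  P [set w | rangeW w < h] = (\sum_(1 <= k <oo) (ddwpr_term T h k)%:E)%E.
Proof.
move=> h0; apply/esym/cvg_lim => //.
have -> : P [set w | rangeW w < h] = (fine (P [set w | rangeW w < h]))%:E.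
  by rewrite fineK// fin_num_measure//; exact: measurable_range_lt.
rewrite -cvg_shiftS.
rewrite (_ : [sequence _]_n = EFin \o (fun n => \sum_(k < n) ddwpr_term T h k.+1)).
  by apply: cvg_EFin; [exact: nearW|exact: cvg_range_cdf].
by apply/funext => n /=; rewrite big_add1/= big_mkord sumEFin.
Qed.

End range_distribution.

Unset Implicit Arguments.

Theorem mainTheorem1 (R : realType) (d : measure_display)
    (Omega : measurableType d) (P : probability Omega R)
    (W : R -> {RV P >-> R}) (T : R)
    (hT : 0 < T) (hW : standard_wiener_process W) (r : nat) :
  [/\ P [set w | discrete_range W T w = r%:Z] =
        (ddwpr_G T (r%:R + 1) - ddwpr_G T r%:R)%E,
      P [set w | discrete_range W T w <= r%:Z] = ddwpr_G T (r%:R + 1) &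
      ddwpr_G T (r%:R + 1) =
        (\sum_(1 <= k <oo)
          ((8 / ((2 * k%:R - 1) ^+ 2 * pi ^+ 2) + 8 * T / (r%:R + 1) ^+ 2) *
           expR (- ((2 * k%:R - 1) ^+ 2 * pi ^+ 2 * T /
                    (2 * (r%:R + 1) ^+ 2))))%:E)%E].
Proof.
have cdf (h : R) : 0 <= h -> P [set w | wiener_range W T w < h] = ddwpr_G T h.
  rewrite le_eqVlt /ddwpr_G => /predU1P[<-|h0]; last first.
    by rewrite gt_eqF// range_cdf.
  rewrite eqxx (_ : [set w | _] = set0) ?measure0//.
  apply/seteqP; split => w //=.
  by rewrite ltNge wiener_range_ge0.
have floor_le (w : Omega) (m : nat) :
    (discrete_range W T w <= m%:Z) = (wiener_range W T w < m%:R + 1).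
  by rewrite /discrete_range -ltzD1 floor_lt_int intrD.
have r1 : 0 <= r%:R + 1 :> R by rewrite addr_ge0.
have cdfr : P [set w | discrete_range W T w <= r%:Z] = ddwpr_G T (r%:R + 1).
  rewrite -cdf//; congr (P _); apply/seteqP; split => w /=; by rewrite floor_le.
split => //; last first.
  by rewrite /ddwpr_G gt_eqF// ltr_wpDl.
rewrite -!cdf//.
have -> : [set w | discrete_range W T w = r%:Z] =
    [set w | wiener_range W T w < r%:R + 1] `\` [set w | wiener_range W T w < r%:R].
  apply/seteqP; split => w /=.
    move=> /eqP; rewrite /discrete_range floor_eq intrD => /andP[rw wr].
    by split=> //; apply/negP; rewrite -leNgt.
  move=> [wr /negP]; rewrite -leNgt => rw.
  by apply/eqP; rewrite /discrete_range floor_eq intrD; apply/andP.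
rewrite measureD ?setIidr//; first by move=> w /= rw; rewrite ltr_wpDr// ltW.
- exact: measurable_range_lt.
- exact: measurable_range_lt.
- by rewrite -ge0_fin_numE// fin_num_measure//; exact: measurable_range_lt.
Qed.
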